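(* Let $(E,\mathcal{E})$ be a measurable space and let $k\in\mathbb{N}$. For each $n\in\mathbb{N}_{>k}$ let $n'\in\mathbb{N}_{>k}$ (depending on $n$), let $\Omega_n\subseteq E^{n'}$, let $\mathcal{F}_n$ be the sigma-algebra on $\Omega_n$ induced by the product sigma-algebra $\mathcal{E}_{n'}$ on $E^{n'}$, and let $\nu_n$ be a probability measure on $(\Omega_n,\mathcal{F}_n)$. Let $f\colon E^k\to\mathbb{R}$ be a measurable function satisfying $$\lim_{m\to\infty}\lim_{n\to\infty}\int_{\Omega_n\cap\{|f|\ge m\}}|f|\,d\nu_n=0.$$ Then $f$ is integrable over $\Omega_n$ for large $n$, so that the sequence $\alpha_{f,n}:=\int_{\Omega_n}f\,d\nu_n$ is well-defined for large $n$. Furthermore, for any $N>\mathbb{N}$, the function $\operatorname{st}({}^*f)$ is Loeb integrable over $(\Omega_N,L(\mathcal{F}_N),L\nu_N)$ and $$\operatorname{st}(\alpha_{f,N})=\int_{\Omega_N}\operatorname{st}({}^*f)\,dL\nu_N.$$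
   Context: Conventions: $\mathcal{E}_j$ is the product sigma-algebra on $E^j$; the sigma-algebra induced on $\Omega_n$ is $\{\Omega_n\cap A:A\in\mathcal{E}_{n'}\}$. A function $f$ on $E^k$ is regarded as a function on $\Omega_n\subseteq E^{n'}$ by composing with the projection onto the first $k$ coordinates (and similarly in the nonstandard universe). Nonstandard setting: fix a sufficiently saturated (at least $\aleph_1$-saturated) nonstandard extension ${}^*$, satisfying the transfer principle, of a superstructure over a set containing $\mathbb{R}$ and copies of $E^n$ for all $n\in\mathbb{N}$. $N>\mathbb{N}$ means $N\in{}^*\mathbb{N}\setminus\mathbb{N}$. Extending the sequence $(\Omega_n,\mathcal{F}_n,\nu_n)_n$ to ${}^*\mathbb{N}$ gives an internal probability space $(\Omega_N,\mathcal{F}_N,\nu_N)$ for each $N>\mathbb{N}$; $\alpha_{f,N}$ is the $N$-th term of the extension of the sequence $(\alpha_{f,n})$. ${}^*\mathbb{R}_{\mathrm{fin}}$ is the set of $x\in{}^*\mathbb{R}$ with $|x|\le m$ for some $m\in\mathbb{N}$; for such $x$, $\operatorname{st}(x)$ is the unique real infinitely close to $x$. The function $\operatorname{st}({}^*f)$ is defined at points where ${}^*f$ is finite (it is understood as defined almost everywhere). For an internal finitely additive probability space $(\Omega,\mathcal{F},\nu)$, the Loeb space $(\Omega,L(\mathcal{F}),L\nu)$ is the completion of the unique countably additive extension of $\operatorname{st}(\nu)$ from the algebra $\mathcal{F}$ to $\sigma(\mathcal{F})$. *)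

(* Defs.v *)
From HB Require Import structures.
From mathcomp Require Import all_boot all_order all_algebra.
From mathcomp Require Import all_classical all_reals all_analysis.
From mathcomp Require Import measurable_realfun.
Set Implicit Arguments.
Unset Strict Implicit.
Unset Printing Implicit Defensive.
Import Order.TTheory GRing.Theory Num.Theory.
Import numFieldNormedType.Exports.
Local Open Scope classical_set_scope.
Local Open Scope ring_scope.

(* V_0(X) = X, V_(n+1)(X) = V_n(X) `|` P(V_n(X)) and V(X) is the union of the
   V_n(X).  An element of V_(n+1)(X) is an atom or a set of elements of V_n(X),
   so it can be presented as an element of X + set (V_n(X)); the presentations
   of one element at different levels are identified by [code_eq], and
   [superstructure X] is the quotient. *)

Fixpoint stage (X : Type) (n : nat) : Type :=
  if n is n'.+1 then (X + set (stage X n'))%type else X.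

Fixpoint stage_eq (X : Type) (m n : nat) : stage X m -> stage X n -> Prop :=
  match m, n return stage X m -> stage X n -> Prop with
  | 0%N, 0%N => fun x y => x = y
  | 0%N, _.+1 => fun x b => b = inl x
  | _.+1, 0%N => fun a y => a = inl y
  | m'.+1, n'.+1 => fun a b =>
      match a, b with
      | inl x, inl y => x = y
      | inr A, inr B =>
          (forall s, A s -> exists2 t, B t & stage_eq s t) /\
          (forall t, B t -> exists2 s, A s & stage_eq s t)
      | _, _ => False
      end
  end.

Definition code (X : Type) : Type := {n : nat & stage X n}.

Definition code_eq (X : Type) (a b : code X) : Prop :=
  stage_eq (projT2 a) (projT2 b).

Definition superstructure (X : Type) : Type :=
  {C : set (code X) | exists a, C = code_eq a}.

Section superstructure_theory.
Variable X : Type.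
Local Notation V := (superstructure X).

Definition decode (n : nat) (s : stage X n) : V :=
  exist _ (code_eq (existT _ n s)) (ex_intro _ (existT _ n s) erefl).

Definition vset0 : V := @decode 1 (inr set0).

HB.instance Definition _ := gen_eqMixin V.
HB.instance Definition _ := gen_choiceMixin V.
HB.instance Definition _ := isPointed.Build V vset0.

Definition atom (x : X) : V := @decode 0 x.

Definition is_atom (a : V) : Prop := exists x, a = atom x.

Definition vmem (a b : V) : Prop :=
  exists n (S : set (stage X n)) (s : stage X n),
    [/\ S s, a = decode s & b = @decode n.+1 (inr S)].

Definition members (a : V) : set V := [set x | vmem x a].

(* The set of V(X) whose elements are the elements of P; it exists as soon as
   P is contained in some V_n(X) (see [membersK]). *)
Definition mkset (P : set V) : V := [get a | ~ is_atom a /\ members a = P].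

Definition vpair (a b : V) : V := mkset [set mkset [set a]; mkset [set a; b]].

(* The graph of arg i |-> val i, for i in D. *)
Definition vfun (I : Type) (D : set I) (arg val : I -> V) : V :=
  mkset [set vpair (arg i) (val i) | i in D].

Definition vapp (g x : V) : V := [get y | vmem (vpair x y) g].

Lemma stage_eq_refl n (s : stage X n) : stage_eq s s.
Proof. by elim: n s => [|n IH] //= [x|A] //=; split=> s As; exists s. Qed.

Lemma stage_eq_sym m n (s : stage X m) (t : stage X n) :
  stage_eq s t -> stage_eq t s.
Proof.
elim: m n s t => [|m IH] [|n] //=.
move=> [x|A] [y|B] //= [H1 H2].
by split=> u; [move/H2|move/H1] => -[v Hv /IH ?]; exists v.
Qed.

Lemma stage_eq_trans m n p (s : stage X m) (t : stage X n) (u : stage X p) :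
  stage_eq s t -> stage_eq t u -> stage_eq s u.
Proof.
elim: m n p s t u => [|m IH] [|n] [|p] /=.
- by move=> x y z -> ->.
- by move=> x y z -> ->.
- by move=> x y z -> [->].
- by move=> x y [z|C] -> //= ->.
- by move=> x y z -> ->.
- by move=> x y z -> ->.
- by move=> [x|A] [y|B] z //= -> // [->].
- move=> [x|A] [y|B] [z|C] //=; first by move=> ->.
  move=> [H1 H2] [H3 H4]; split.
    by move=> a /H1[b /H3[c Cc bc] ab]; exists c => //; exact: IH ab bc.
  by move=> c /H4[b /H2[a Aa ab] bc]; exists a => //; exact: IH ab bc.
Qed.

Lemma decode_eq m n (s : stage X m) (t : stage X n) :
  decode s = decode t <-> stage_eq s t.
Proof.
split=> [[]st|st].
  suff : code_eq (existT _ m s) (existT _ n t) by [].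
  by rewrite st; exact: stage_eq_refl.
apply: eq_exist; apply/seteqP; split=> -[p u]; rewrite /code_eq /=.
  by apply: stage_eq_trans; exact: stage_eq_sym.
exact: stage_eq_trans.
Qed.

Lemma decode_surj (a : V) : exists n (s : stage X n), a = decode s.
Proof.
by case: a => C CE; have [[n s] Cns] := CE; exists n, s; exact: eq_exist.
Qed.

Lemma is_atom_decode n (A : set (stage X n)) :
  ~ is_atom (@decode n.+1 (inr A)).
Proof. by case=> x /decode_eq. Qed.

Lemma members_decode n (A : set (stage X n)) :
  members (@decode n.+1 (inr A)) = @decode n @` A.
Proof.
apply/seteqP; split=> [a|_ [s As <-]]; last by exists n, A, s.
move=> [p [B [s [Bs -> /decode_eq[_ H]]]]].
by have [t At /decode_eq ts] := H _ Bs; exists t.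
Qed.

Lemma members_atom (x : X) : members (atom x) = set0.
Proof.
apply/seteqP; split=> // a [p [B [s [_ _ /decode_eq]]]].
by [].
Qed.

Lemma members_inj (a b : V) :
  ~ is_atom a -> ~ is_atom b -> members a = members b -> a = b.
Proof.
have setP c : ~ is_atom c ->
    exists n (A : set (stage X n)), c = @decode n.+1 (inr A).
  have [[|n] [s ->]] := decode_surj c; first by case; exists s.
  case: s => [x|A] nat; last by exists n, A.
  by case: nat; exists x; apply/decode_eq.
move=> /setP[m [A ->]] /setP[n [B ->]]; rewrite !members_decode => AB.
apply/decode_eq; split=> [s As|t Bt].
  have [t Bt /esym/decode_eq st] : (@decode n @` B) (decode s).
    by rewrite -AB; exists s.
  by exists t.
have [s As /decode_eq st] : (@decode m @` A) (decode t).
  by rewrite AB; exists t.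
by exists s.
Qed.

Lemma membersK n (P : set V) : P `<=` range (@decode n) ->
  ~ is_atom (mkset P) /\ members (mkset P) = P.
Proof.
move=> Pn; apply: (@getPex _ [set a | ~ is_atom a /\ members a = P]).
exists (@decode n.+1 (inr (@decode n @^-1` P))).
split; first exact: is_atom_decode.
rewrite members_decode; apply/seteqP; split=> [_ [s Ps <-] //|a /[dup] Pa].
by move=> /Pn[s _ sa]; exists s; rewrite /preimage/= ?sa.
Qed.

Lemma range_decodeS n : range (@decode n) `<=` range (@decode n.+1).
Proof.
suff H (s : stage X n) : exists t : stage X n.+1, stage_eq s t.
  by move=> _ [s _ <-]; have [t /decode_eq ->] := H s; exists t.
elim: n s => [x|n IH [x|A]]; first by exists (inl x).
  by exists (inl x).
exists (inr [set t : stage X n.+1 | exists2 s, A s & stage_eq s t]).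
split=> [s As|t [s As st]].
  by have [t st] := IH s; exists t => //; exists s.
by exists s.
Qed.

End superstructure_theory.

(* Formulas of the language of membership and equality whose quantifiers are
   bounded.  Variables are de Bruijn indices; parameters are the values of the
   free variables.  The other connectives are definable. *)
Inductive bformula : Type :=
| BMem of nat & nat
| BEq of nat & nat
| BNot of bformula
| BAnd of bformula & bformula
| BAllIn of nat & bformula.

Definition push (V : Type) (x : V) (e : nat -> V) (i : nat) : V :=
  if i is j.+1 then e j else x.

Fixpoint bsat (X : Type) (p : bformula) (e : nat -> superstructure X) : Prop :=
  match p with
  | BMem i j => vmem (e i) (e j)
  | BEq i j => e i = e j
  | BNot q => ~ bsat q e
  | BAnd q r => bsat q e /\ bsat r e
  | BAllIn i q => forall x, vmem x (e i) -> bsat q (push x e)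
  end.

Definition internal (X Y : Type) (star : superstructure X -> superstructure Y)
    (a : superstructure Y) : Prop :=
  exists b, vmem a (star b).

Definition atoms (X : Type) : superstructure X := mkset (@is_atom X).

Record nonstandard_extension (X Y : Type)
    (star : superstructure X -> superstructure Y) : Prop :=
  NonstandardExtension {
    star_base : star (atoms X) = atoms Y ;
    star_transfer : forall (p : bformula) (e : nat -> superstructure X),
      bsat p e <-> bsat p (star \o e) ;
    star_aleph1_saturated : forall A : nat -> superstructure Y,
      (forall i, internal star (A i)) ->
      (forall n, exists x, forall i, (i <= n)%N -> vmem x (A i)) ->
      exists x, forall i, vmem x (A i) }.

Record base_embedding (R E X : Type) : Type := BaseEmbedding {
  base_real : R -> X ;
  base_tuple : forall n, n.-tuple E -> X ;
  base_real_inj : injective base_real ;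
  base_tuple_inj : forall n, injective (@base_tuple n) }.

(* Measurable types are pointed, so a subset has to be nonempty to carry one. *)
Definition subset_type (T : Type) (A : set T) (A0 : A !=set0) : Type :=
  {x : T | A x}.

Section subset_type_instances.
Variables (T : Type) (A : set T) (A0 : A !=set0).
HB.instance Definition _ := gen_eqMixin (subset_type A0).
HB.instance Definition _ := gen_choiceMixin (subset_type A0).
HB.instance Definition _ := isPointed.Build (subset_type A0) (cid A0).
End subset_type_instances.

Definition subset_val (T : Type) (A : set T) (A0 : A !=set0) (x : subset_type A0) : T :=
  sval x.
Arguments subset_val {T A} A0 x.

Notation induced_space A0 := (g_sigma_algebra_preimageType (subset_val A0)).

Definition tuple_proj (E : Type) (k n : nat) (kn : (k <= n)%N) (x : n.-tuple E) :
    k.-tuple E :=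
  [tuple tnth x (widen_ord kn i) | i < k].

Section standard_objects.
Context (R : realType) (d : measure_display) (E : measurableType d) (X : Type).
Variable b : base_embedding R E X.
Local Notation V := (superstructure X).

Definition vreal (r : R) : V := atom (base_real b r).
Definition vtuple (n : nat) (x : n.-tuple E) : V := atom (base_tuple b x).

Definition vR : V := mkset (range vreal).
Definition vN : V := mkset (range (fun n : nat => vreal n%:R)).
Definition vle : V :=
  mkset [set vpair (vreal p.1) (vreal p.2) | p in [set p : R * R | p.1 <= p.2]].
Definition vsub : V :=
  vfun [set: R * R] (fun p => vpair (vreal p.1) (vreal p.2))
    (fun p => vreal (p.1 - p.2)).
Definition vnorm : V := vfun [set: R] vreal (fun r => vreal `|r|).

(* Natural numbers are the atoms of the corresponding reals.  The sequence is
   (u n)_(n > k): the values of u at n <= k are not used. *)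
Definition vseq (k : nat) (u : nat -> V) : V :=
  vfun [set n | (k < n)%N] (fun n => vreal n%:R) u.

(* The data at the indices n <= k is arbitrary and enters none of the sequences
   below.  np n is the dimension n' of the ambient space of Omega_n. *)
Variables (k : nat) (np : nat -> nat) (knp : forall n, (k < np n)%N).
Variable Omega : forall n, set ((np n).-tuple E).
Arguments Omega : clear implicits.
Variables (Omega0 : forall n, Omega n !=set0).
Variables (nu : forall n, probability (induced_space (Omega0 n)) R).
Variable f : k.-tuple E -> R.

Definition pull (n : nat) (x : induced_space (Omega0 n)) : R :=
  f (tuple_proj (ltnW (knp n)) (subset_val (Omega0 n) x)).

Definition vsubset (n : nat) (A : set (induced_space (Omega0 n))) : V :=
  mkset [set vtuple (subset_val (Omega0 n) x) | x in A].

Definition vf : V := vfun [set: k.-tuple E] (@vtuple k) (fun x => vreal (f x)).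

Definition vOmega_seq : V := vseq k (fun n => vsubset [set: induced_space (Omega0 n)]).

Definition vF_seq : V :=
  vseq k (fun n => mkset (@vsubset n @` measurable)).

Definition vnu_seq : V :=
  vseq k (fun n => vfun measurable (@vsubset n) (fun A => vreal (fine (nu n A)))).

Definition vproj_seq : V :=
  vseq k (fun n => vfun [set: (np n).-tuple E] (@vtuple (np n))
    (fun x => vtuple (tuple_proj (ltnW (knp n)) x))).

(* alpha_(f,n) is only defined for the n > k such that f is integrable. *)
Definition valpha_seq : V :=
  vfun [set n | (k < n)%N /\ (nu n).-integrable setT (EFin \o @pull n)]
    (fun n => vreal n%:R) (fun n => vreal (\int[nu n]_x pull x)%R).

End standard_objects.
Arguments pull {R d E k np} knp {Omega} Omega0 f n x.

Section hyperreal.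
Context (R : realType) (d : measure_display) (E : measurableType d).
Variables (X Y : Type) (b : base_embedding R E X).
Variable star : superstructure X -> superstructure Y.
Local Notation V := (superstructure Y).

Definition infinite_hypernat (N : V) : Prop :=
  vmem N (star (vN b)) /\ forall n : nat, N <> star (vreal b n%:R).

Definition hle (x y : V) : Prop := vmem (vpair x y) (star (vle b)).
Definition hsub (x y : V) : V := vapp (star (vsub b)) (vpair x y).
Definition hnorm (x : V) : V := vapp (star (vnorm b)) x.

Definition finite_hyperreal (x : V) : Prop :=
  vmem x (star (vR b)) /\ exists m : nat, hle (hnorm x) (star (vreal b m%:R)).

Definition infinitely_close (x y : V) : Prop :=
  forall e : R, 0 < e -> hle (hnorm (hsub x y)) (star (vreal b e)).

(* The value is 0 when x is not finite. *)
Definition st (x : V) : R :=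
  xget 0 [set r | finite_hyperreal x /\ infinitely_close x (star (vreal b r))].

Variables (Omega F nu : V).
Hypothesis Omega0 : members Omega !=set0.

Definition trace_set (B : V) : set (subset_type Omega0) :=
  [set x | vmem (subset_val Omega0 x) B].

Definition internal_algebra : set (set (subset_type Omega0)) :=
  trace_set @` members F.

Definition extends_st
    (lam : {measure set (g_sigma_algebraType internal_algebra) -> \bar R}) :=
  forall B, vmem B F -> lam (trace_set B) = (st (vapp nu B))%:E.

End hyperreal.
Arguments extends_st {R d E X Y} b star {Omega} F nu Omega0 lam.

(* The completion of a measure: the sigma-algebra of the sets A `|` N with A
   measurable and N negligible, on which the unique extension of mu is the
   restriction of its outer measure. *)
Section completion.
Context (d : measure_display) (T : measurableType d) (R : realType).
Variable mu : {measure set T -> \bar R}.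

Definition completed_type : Type := g_sigma_algebraType (completed_algebra_gen mu).

HB.instance Definition _ := Measurable.on completed_type.

Definition completion : set completed_type -> \bar R := mu_ext mu.

Let completed_caratheodory (A : set completed_type) :
  measurable A -> caratheodory_measurable (mu_ext mu) A.
Proof.
have: sigma_algebra setT (caratheodory_measurable (mu_ext mu)).
  split=> [|B|]; first exact: caratheodory_measurable_set0.
    by rewrite setTD; exact: caratheodory_measurable_setC.
  exact: caratheodory_measurable_bigcup.
move=> cara; apply: smallest_sub => // _ [B mB] [N [M [mM M0 NM]]] <-.
apply: caratheodory_measurable_setU; first exact: caratheodory_measurable_mu_ext.
apply: le_caratheodory_measurable => Z.
apply: (@le_trans _ _ (mu_ext mu N + mu_ext mu (Z `&` ~` N))%E).
  by rewrite leeD2r//; apply: le_outer_measure; exact: subIsetr.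
have -> : mu_ext mu N = 0%E.
  apply/eqP; rewrite eq_le outer_measure_ge0 andbT -M0 -(measurable_mu_extE mu)//.
  exact: le_outer_measure.
by rewrite add0e; apply: le_outer_measure; exact: subIsetl.
Qed.

Let completion0 : completion set0 = 0.
Proof. exact: outer_measure0. Qed.

Let completion_ge0 A : (0 <= completion A)%E.
Proof. exact: outer_measure_ge0. Qed.

Let completion_semi_sigma_additive : semi_sigma_additive completion.
Proof.
move=> F mF tF mUF; apply: caratheodory_measure_sigma_additive => //.
  by move=> i; exact: completed_caratheodory.
exact: completed_caratheodory.
Qed.

HB.instance Definition _ := isMeasure.Build _ _ _ completion
  completion0 completion_ge0 completion_semi_sigma_additive.

End completion.
Arguments completion {d T R} mu A.

(* Main.v *)
Require Import Defs.
From HB Require Import structures.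
From mathcomp Require Import all_boot all_order all_algebra.
From mathcomp Require Import all_classical all_reals all_analysis.
From mathcomp Require Import measurable_realfun lra.
Import Defs.
Set Implicit Arguments.
Unset Strict Implicit.
Unset Printing Implicit Defensive.
Import Order.TTheory GRing.Theory Num.Theory.
Import numFieldNormedType.Exports.
Local Open Scope classical_set_scope.
Local Open Scope ring_scope.

(* The sets A of indices with N in *A form an ultrafilter U finer than \oo, and by
   Los's theorem a bounded formula holds of the N-th terms of finitely many
   sequences iff it holds of their n-th terms for U-many n.  Hence F_N is an
   algebra on which st nu_N is finitely additive; by aleph_1-saturation a
   disjoint countable union that stays in the algebra is a finite union, so
   Caratheodory extends st nu_N.  For Borel A the set {x | *f x in *A} has Loeb
   measure lim_U nu_n(f in A).  Cutting the range of a bounded 1-Lipschitz phi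
   into short intervals then gives int phi(st *f) = lim_U int phi(f) dnu_n.
   Applied to phi = min(k, |.|) this bounds int |st *f|, and applied to the
   truncations of f, whose error is controlled by the tail integrals, it gives
   the equality of the integrals. *)

(** * Sets, pairs and functions in the superstructure *)

(** Each point x of Omega_N gives the ultrafilter W x of the sets A of reals with *f x in *A; it
    converges to the standard part of *f x when *f x is finite. Phrased with these ultrafilters, the
    integration argument contains no nonstandard object, and the measurability of st *f comes from
    that of the sets {x | *f x in *A} for Borel A. The tail hypothesis is also what makes *f finite
    almost everywhere. The obstacle before that is syntactic. Transfer concerns bounded formulas
    without function symbols, whereas N-th terms, measures and values of *f are given by [vapp], a
    choice in a graph. Such a value is therefore described by a witness in the extension of a
    standard set, together with a uniqueness clause whose quantifiers run through iterated members
    of the graph. Relations such as nu_N B in *A are turned into membership in the N-th term of an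
    auxiliary sequence of standard sets, so that additivity of nu_N, for instance, transfers without
    any internal addition. *)

Section superstructure_rank.
Variable X : Type.
Local Notation V := (superstructure X).

(** Set formation is sound only below a fixed stage: [mkset P] is a choice by [get], and a bound on
    the rank guarantees that its members are those of P. *)
Definition ranked (P : set V) := exists n, P `<=` range (@decode X n).

Lemma range_decode_le m n : (m <= n)%N ->
  range (@decode X m) `<=` range (@decode X n).
Proof.
move=> /subnK <-; elim: (n - m)%N => [//|p IH].
by apply: subset_trans IH _; exact: range_decodeS.
Qed.

Lemma ranked_sub (P Q : set V) : P `<=` Q -> ranked Q -> ranked P.
Proof. by move=> PQ [n Qn]; exists n; exact: subset_trans Qn. Qed.

Lemma ranked1 (a : V) : ranked [set a].
Proof. by have [n [s ->]] := decode_surj a; exists n => _ ->; exists s. Qed.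

Lemma rankedU (P Q : set V) : ranked P -> ranked Q -> ranked (P `|` Q).
Proof.
move=> [m Pm] [n Qn]; exists (maxn m n); rewrite subUset; split.
  by apply: subset_trans Pm _; apply: range_decode_le; rewrite leq_maxl.
by apply: subset_trans Qn _; apply: range_decode_le; rewrite leq_maxr.
Qed.

Lemma mem_mkset (P : set V) a : ranked P -> vmem a (mkset P) <-> P a.
Proof.
by move=> [n /membersK[_ PE]]; rewrite -[X in _ <-> X a]PE.
Qed.

Lemma mkset_natom (P : set V) : ranked P -> ~ is_atom (mkset P).
Proof. by move=> [n /membersK[]]. Qed.

Lemma mksetP (P : set V) a : ranked P -> ~ is_atom a ->
  (forall x, vmem x a <-> P x) -> a = mkset P.
Proof.
move=> rP na aP; apply: members_inj => //; first exact: mkset_natom.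
apply/seteqP; split=> x; first by move=> /aP Px; exact/(mem_mkset _ rP).
by move=> /(mem_mkset _ rP) /aP.
Qed.

Lemma mem_natom (x a : V) : vmem x a -> ~ is_atom a.
Proof.
by move=> xa [y ay]; have : members a x by []; rewrite ay members_atom.
Qed.

Lemma mkset_range n (P : set V) : P `<=` range (@decode X n) ->
  range (@decode X n.+1) (mkset P).
Proof.
move=> Pn; exists (inr (@decode X n @^-1` P)) => //; apply: mksetP.
- by exists n.
- exact: is_atom_decode.
- move=> x; rewrite -[vmem _ _]/(members _ _) members_decode; split.
    by move=> [s Ps <-].
  by move=> /[dup] /Pn[s _ <-] Ps; exists s.
Qed.

Lemma vpair_range n (a b : V) : range (@decode X n) a ->
  range (@decode X n) b -> range (@decode X n.+2) (vpair a b).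
Proof.
move=> na nb; apply: mkset_range => _ [->|->]; apply: mkset_range.
  by move=> _ ->.
by move=> _ [->|->].
Qed.

Lemma ranked2 (a b : V) : ranked [set a; b].
Proof. by apply: rankedU; exact: ranked1. Qed.

Lemma mem_set1 (z a : V) : vmem z (mkset [set a]) <-> z = a.
Proof. by rewrite mem_mkset//; exact: ranked1. Qed.

Lemma mem_set2 (z a b : V) : vmem z (mkset [set a; b]) <-> z = a \/ z = b.
Proof. by rewrite mem_mkset//; exact: ranked2. Qed.

(** Kuratowski pairs in bounded form: u is the singleton, v the doubleton, and every quantifier is
    bounded by p, u or v. This is what makes pairing definable. *)
Lemma vpairP (p a b : V) : p = vpair a b <->
  exists2 u, vmem u p & exists2 v, vmem v p &
    [/\ forall w, vmem w p -> w = u \/ w = v,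
        vmem a u, forall w, vmem w u -> w = a,
        vmem a v /\ vmem b v & forall w, vmem w v -> w = a \/ w = b].
Proof.
split=> [->|[u up [v vp [puv au ua [av bv] vab]]]].
  exists (mkset [set a]); first by apply/mem_set2; left.
  exists (mkset [set a; b]); first by apply/mem_set2; right.
  split; [by move=> w /mem_set2|by apply/mem_set1|by move=> w /mem_set1|
    by split; apply/mem_set2; [left|right]|by move=> w /mem_set2].
have -> : vpair a b = mkset [set u; v].
  rewrite /vpair; congr (mkset [set _; _]); apply/esym/mksetP.
  - exact: ranked1.
  - exact: mem_natom au.
  - by move=> x; split=> [/ua//|->].
  - exact: ranked2.
  - exact: mem_natom av.
  - by move=> x; split=> [/vab//|[->|->]].
apply: mksetP; [exact: ranked2|exact: mem_natom up|].
by move=> x; split=> [/puv//|[->|->]].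
Qed.

Lemma mem_vpair (z a b : V) :
  vmem z (vpair a b) <-> z = mkset [set a] \/ z = mkset [set a; b].
Proof. exact: mem_set2. Qed.

Lemma vpair_inj (a b a' b' : V) : vpair a b = vpair a' b' -> a = a' /\ b = b'.
Proof.
move=> E.
have aa : a = a'.
  have : vmem (mkset [set a']) (vpair a b) by rewrite E; apply/mem_vpair; left.
  have a'1 : vmem a' (mkset [set a']) by exact/mem_set1.
  move=> /mem_vpair[]E1; first by move: a'1; rewrite E1 => /mem_set1.
  have : vmem a (mkset [set a']) by rewrite E1; apply/mem_set2; left.
  by move=> /mem_set1.
subst a'; split=> //.
have key c c' : vpair a c = vpair a c' -> c = a \/ c = c'.
  move=> Ec; have : vmem (mkset [set a; c]) (vpair a c').
    by rewrite -Ec; apply/mem_vpair; right.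
  have cc : vmem c (mkset [set a; c]) by apply/mem_set2; right.
  by move=> /mem_vpair[]E1; move: cc; rewrite E1; [move/mem_set1; left|move/mem_set2].
case: (key _ _ E) => // ba; case: (key _ _ (esym E)) => // b'a.
by rewrite ba b'a.
Qed.

Section vfun.
Context (I : Type) (D : set I) (arg val : I -> V).
Hypothesis rarg : ranked (range arg).
Hypothesis rval : ranked (range val).

Lemma ranked_pairs : ranked [set vpair (arg i) (val i) | i in D].
Proof.
have [n nr] := rankedU rarg rval; exists n.+2 => _ [i Di <-].
by apply: vpair_range; apply: nr; [left|right]; exists i.
Qed.

Lemma mem_vfun q :
  vmem q (vfun D arg val) <-> exists2 i, D i & q = vpair (arg i) (val i).
Proof.
rewrite /vfun mem_mkset; last exact: ranked_pairs.
by split=> -[i Di ?]; exists i.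
Qed.

Lemma mem_vfun_pair x y : vmem (vpair x y) (vfun D arg val) <->
  exists2 i, D i & x = arg i /\ y = val i.
Proof.
rewrite mem_vfun; split=> -[i Di]; first by move=> /vpair_inj; exists i.
by move=> [-> ->]; exists i.
Qed.

(** Uniqueness is asked of z in a, a in q, q in h, and not of all z, so that the hypothesis is a
    bounded formula. It loses nothing: the second component of a pair q is a member of the doubleton
    that belongs to q. *)
Lemma vapp_eq (h x y : V) : vmem (vpair x y) h ->
  (forall q, vmem q h -> forall a, vmem a q -> forall z, vmem z a ->
    q = vpair x z -> z = y) -> vapp h x = y.
Proof.
move=> xy uy; have xv : vmem (vpair x (vapp h x)) h.
  by apply: (@getPex _ [set y | vmem (vpair x y) h]); exists y.
apply: (uy _ xv (mkset [set x; vapp h x])) => //.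
  by apply/mem_vpair; right.
by apply/mem_set2; right.
Qed.

Lemma vfun_range n : range arg `<=` range (@decode X n) ->
  range val `<=` range (@decode X n) -> range (@decode X n.+3) (vfun D arg val).
Proof.
move=> an vn; apply: mkset_range => _ [i Di <-].
by apply: vpair_range; [apply: an|apply: vn]; exists i.
Qed.

End vfun.

End superstructure_rank.

(** * Definable predicates *)

(** Predicates are uniform in the base type, so that one and the same predicate is read on both
    sides of transfer. *)
Definition vpred := forall Z : Type, (nat -> superstructure Z) -> Prop.

Definition definable (P : vpred) :=
  exists p, forall Z e, @bsat Z p e <-> P Z e.

Fixpoint brename (s : nat -> nat) (p : bformula) : bformula :=
  match p with
  | BMem i j => BMem (s i) (s j)
  | BEq i j => BEq (s i) (s j)
  | BNot q => BNot (brename s q)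
  | BAnd q r => BAnd (brename s q) (brename s r)
  | BAllIn i q => BAllIn (s i) (brename (fun j => if j is l.+1 then (s l).+1 else 0%N) q)
  end.

Lemma bsat_rename (X : Type) p s (e : nat -> superstructure X) :
  bsat (brename s p) e <-> bsat p (e \o s).
Proof.
elim: p s e => [i j|i j|q IH|q IHq r IHr|i q IH] s e //=.
- by rewrite IH.
- by rewrite IHq IHr.
- have E x : push x e \o (fun j => if j is l.+1 then (s l).+1 else 0%N) = push x (e \o s).
    by apply/funext => -[].
  by split=> H x /H; rewrite IH E.
Qed.

Section closure.
Implicit Types P Q : vpred.

Lemma definable_iff P Q : (forall Z e, P Z e <-> Q Z e) -> definable P -> definable Q.
Proof. by move=> PQ [p pP]; exists p => Z e; rewrite pP PQ. Qed.

Lemma definable_mem i j : definable (fun Z e => vmem (e i) (e j)).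
Proof. by exists (BMem i j). Qed.

Lemma definable_eq i j : definable (fun Z e => e i = e j).
Proof. by exists (BEq i j). Qed.

Lemma definable_not P : definable P -> definable (fun Z e => ~ P Z e).
Proof. by move=> [p pP]; exists (BNot p) => Z e /=; rewrite pP. Qed.

Lemma definable_and P Q : definable P -> definable Q ->
  definable (fun Z e => P Z e /\ Q Z e).
Proof. by move=> [p pP] [q qQ]; exists (BAnd p q) => Z e /=; rewrite pP qQ. Qed.

Lemma definable_imp P Q : definable P -> definable Q ->
  definable (fun Z e => P Z e -> Q Z e).
Proof.
move=> dP dQ; apply: definable_iff (definable_not (definable_and dP (definable_not dQ))).
by move=> Z e; split=> [H Pe|H [Pe]]; [apply: contrapT => nQ; exact: H|apply; exact: H].
Qed.

Lemma definable_or P Q : definable P -> definable Q ->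
  definable (fun Z e => P Z e \/ Q Z e).
Proof.
move=> dP dQ; apply: definable_iff (definable_imp (definable_not dP) dQ).
by move=> Z e; split=> [H|[Pe|Qe]//]; have [|/H] := pselect (P Z e); [left|right].
Qed.

Lemma definable_equiv P Q : definable P -> definable Q ->
  definable (fun Z e => P Z e <-> Q Z e).
Proof. by move=> dP dQ; apply: definable_and; apply: definable_imp. Qed.

(** The body receives the bound object as a separate argument; predicates written with named
    variables then unify with it, and no de Bruijn formula has to be written by hand. *)
Lemma definable_all i (P : forall Z, superstructure Z -> (nat -> superstructure Z) -> Prop) :
  definable (fun Z e => P Z (e 0%N) (fun j => e j.+1)) ->
  definable (fun Z e => forall x, vmem x (e i) -> P Z x e).
Proof.
move=> [p pP]; exists (BAllIn i p) => Z e /=.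
by split=> H x /H; rewrite pP.
Qed.

Lemma definable_ex2 i (P : forall Z, superstructure Z -> (nat -> superstructure Z) -> Prop) :
  definable (fun Z e => P Z (e 0%N) (fun j => e j.+1)) ->
  definable (fun Z e => exists2 x, vmem x (e i) & P Z x e).
Proof.
move=> dP; apply: definable_iff (definable_not (definable_all i
  (P := fun Z x e => ~ P Z x e) (definable_not dP))) => Z e.
split=> [H|[x xi Px] /(_ x xi)//]; apply: contrapT => nH; apply: H => x xi Px.
by apply: nH; exists x.
Qed.

Lemma definable_rename P s : definable P -> definable (fun Z e => P Z (e \o s)).
Proof. by move=> [p pP]; exists (brename s p) => Z e; rewrite bsat_rename. Qed.

End closure.

Ltac definable_step :=
  first [ exact: definable_mem | exact: definable_eq
        | apply: definable_all => /= | apply: definable_ex2 => /=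
        | apply: definable_and | apply: definable_or
        | apply: definable_not
        | apply: definable_equiv
        | apply: definable_imp ].

Lemma definable_pair i j l : definable (fun Z e => e i = vpair (e j) (e l)).
Proof.
apply: (definable_iff (P := fun Z e => exists2 u, vmem u (e i) &
  exists2 v, vmem v (e i) &
    (forall w, vmem w (e i) -> w = u \/ w = v) /\
    vmem (e j) u /\ (forall w, vmem w u -> w = e j) /\
    (vmem (e j) v /\ vmem (e l) v) /\ (forall w, vmem w v -> w = e j \/ w = e l))).
  move=> Z e; rewrite vpairP; split=> -[u ui [v vi]].
    by move=> [? [? [? [? ?]]]]; exists u => //; exists v.
  by move=> [? ? ? ? ?]; exists u => //; exists v.
by repeat definable_step.
Qed.

Lemma definable_pair_mem i j l : definable (fun Z e => vmem (vpair (e i) (e j)) (e l)).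
Proof.
apply: (definable_iff (P := fun Z e => exists2 q, vmem q (e l) & q = vpair (e i) (e j))).
  by move=> Z e; split=> [[q ql <-//]|]; exists (vpair (e i) (e j)).
by apply: definable_ex2 => /=; exact: definable_pair.
Qed.

Ltac definable_tac :=
  repeat first [exact: definable_pair | exact: definable_pair_mem | definable_step].

(** * Los's theorem *)

Section los.
Context (X Y : Type) (star : superstructure X -> superstructure Y).
Hypothesis hstar : nonstandard_extension star.

Lemma transfer P e : definable P -> P X e <-> P Y (star \o e).
Proof. by move=> [p pP]; rewrite -!pP; exact: star_transfer. Qed.

Lemma comp_push a e : star \o push a e = push (star a) (star \o e).
Proof. by apply/funext => -[]. Qed.

Section point.
Context (I : Type) (iota : I -> superstructure X) (x : superstructure Y).
Hypothesis iota_inj : injective iota.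
Hypothesis iota_ranked : ranked (range iota).

(* The ultrafilter of the A such that x lies in the extension of iota @` A. *)
Definition ultra : set_system I := [set A | vmem x (star (mkset (iota @` A)))].

Hypothesis xI : ultra setT.

Lemma mem_mkset_image (A : set I) i : vmem (iota i) (mkset (iota @` A)) <-> A i.
Proof.
rewrite mem_mkset; last by apply: ranked_sub iota_ranked => _ [j _ <-]; exists j.
by split=> [[j Aj /iota_inj <-]//|Ai]; exists i.
Qed.

(** The set A of the indices where P holds is itself standard, so [y] in A iff P at y, for all y in
    the index set, is one bounded sentence with A as a parameter. Its transfer, read at x, is the
    claim. *)
Lemma los_base P (c : nat -> superstructure X) : definable P ->
  P Y (push x (star \o c)) <-> ultra [set i | P X (push (iota i) c)].
Proof.
move=> dP; set A := [set i | _].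
pose Q : vpred := fun Z e => forall y, vmem y (e 0%N) ->
  (vmem y (e 1%N) <-> P Z (push y (fun j => e j.+2))).
have dQ : definable Q.
  apply: definable_all; apply: definable_equiv => /=; first exact: definable_mem.
  apply: definable_iff (definable_rename (fun j => if j is l.+1 then l.+3 else 0%N) dP).
  move=> Z e; have -> //: e \o (fun j => if j is l.+1 then l.+3 else 0%N) =
    push (e 0%N) (fun j => e j.+3) by apply/funext => -[].
have : Q X (push (mkset (range iota)) (push (mkset (iota @` A)) c)).
  by move=> y /(mem_mkset _ iota_ranked)[i _ <-]; rewrite mem_mkset_image.
rewrite (transfer _ dQ) !comp_push => /(_ x); rewrite /Q /= => /(_ xI).
by move=> <-.
Qed.

(** Each axiom is [los_base] for a Boolean combination of memberships in A and B. *)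
#[global] Instance ultra_filter : ProperFilter ultra.
Proof.
have key P (A B : set I) : definable P -> P Y (push x (push (star (mkset (iota @` A)))
    (push (star (mkset (iota @` B))) (fun=> star (vset0 X))))) <->
  ultra [set i | P X (push (iota i) (push (mkset (iota @` A))
    (push (mkset (iota @` B)) (fun=> vset0 X))))].
  move=> dP; rewrite -los_base// !comp_push.
  by have -> : (star \o fun _ : nat => vset0 X) = (fun=> star (vset0 X)) by [].
split.
  have -> : set0 = [set i : I | vmem (iota i) (mkset (iota @` setT)) /\
       ~ vmem (iota i) (mkset (iota @` setT))] by apply/seteqP; split=> i // [].
  have := key (fun Z e => vmem (e 0%N) (e 1%N) /\ ~ vmem (e 0%N) (e 1%N)) setT setT.
  by move=> /(_ (definable_and (definable_mem _ _) (definable_not (definable_mem _ _))))/= <- [].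
split=> //.
  move=> A B UA UB.
  have -> : A `&` B = [set i : I | vmem (iota i) (mkset (iota @` A)) /\
     vmem (iota i) (mkset (iota @` B))] by apply/seteqP; split=> i /=; rewrite !mem_mkset_image.
  have := key (fun Z e => vmem (e 0%N) (e 1%N) /\ vmem (e 0%N) (e 2%N)) A B.
  by move=> /(_ (definable_and (definable_mem _ _) (definable_mem _ _)))/= <-.
move=> A B AB UA.
have UT : ultra [set i : I | vmem (iota i) (mkset (iota @` A)) ->
     vmem (iota i) (mkset (iota @` B))].
  suff -> : [set i : I | vmem (iota i) (mkset (iota @` A)) ->
     vmem (iota i) (mkset (iota @` B))] = setT by [].
  by apply/seteqP; split=> i //= _; rewrite !mem_mkset_image => /AB.
have := key (fun Z e => vmem (e 0%N) (e 1%N) -> vmem (e 0%N) (e 2%N)) A B.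
move=> /(_ (definable_imp (definable_mem _ _) (definable_mem _ _)))/= [_ /(_ UT)].
exact.
Qed.

Lemma ultraC (A : set I) : ultra A \/ ultra (~` A).
Proof.
have [|nUA] := pselect (ultra A); [by left|right].
have := @los_base (fun Z e => ~ vmem (e 0%N) (e 1%N)) (fun=> mkset (iota @` A)).
move=> /(_ (definable_not (definable_mem _ _)))[/(_ nUA) + _].
by apply: filterS => i /= + Ai; apply; apply/mem_mkset_image.
Qed.

Lemma los_all P (c : nat -> superstructure X) : definable P ->
  (forall i, P X (push (iota i) c)) -> P Y (push x (star \o c)).
Proof. by move=> dP PX; apply/los_base => //; exact: filterE. Qed.

Definition point_or_const : set (superstructure Y * (I -> superstructure X)) :=
  [set a | a = (x, iota) \/ exists c, a = (star c, fun=> c)].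

(* A pair (a, u) stands for the object a in the extension whose coordinates
   along the ultrafilter are given by the sequence u. *)
Definition los_on (L : set (superstructure Y * (I -> superstructure X))) :=
  forall P, definable P -> forall e : nat -> _, (forall i, L (e i)) ->
  P Y (fun i => (e i).1) <-> ultra [set j | P X (fun i => (e i).2 j)].

(** An environment of this kind is a renaming of x followed by constants: [s] sends each position
    that holds the point to variable 0 and shifts the others. *)
Lemma los_on_point : los_on point_or_const.
Proof.
move=> P dP e eL.
pose s i := if `[<e i = (x, iota)>] then 0%N else i.+1.
have [c cE] : {c & forall i, s i = i.+1 -> e i = (star (c i), fun=> c i)}.
  apply: (@choice _ _ (fun i ci => s i = i.+1 -> e i = (star ci, fun=> ci))) => i.
  have [ei|[ci ->]] := eL i; last by exists ci.
  by exists (vset0 X); rewrite /s ei asboolT.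
have sE i : s i = 0%N /\ e i = (x, iota) \/ s i = i.+1 /\ e i = (star (c i), fun=> c i).
  have [ei|ei] := pselect (e i = (x, iota)).
    by left; rewrite /s asboolT.
  by right; split; [rewrite /s asboolF|apply: cE; rewrite /s asboolF].
have E1 : (fun i => (e i).1) = push x (star \o c) \o s.
  by apply/funext => i /=; have [[-> ->]|[-> ->]] := sE i.
have E2 j : (fun i => (e i).2 j) = push (iota j) c \o s.
  by apply/funext => i /=; have [[-> ->]|[-> ->]] := sE i.
rewrite E1; have -> := los_base c (definable_rename s dP).
by split; apply: filterS => j /=; rewrite E2.
Qed.

(** Being total and functional at an index of D is a bounded property once the range of u is a
    parameter. As D lies in the ultrafilter, it holds at x, so [vapp] returns a genuine value and
    not the default of [get]. *)
Lemma vfun_at D u (g := vfun D iota u) : ultra D -> ranked (range u) ->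
  [/\ vmem (vapp (star g) x) (star (mkset (range u))),
      vmem (vpair x (vapp (star g) x)) (star g) &
      forall y, vmem (vpair x y) (star g) -> y = vapp (star g) x].
Proof.
move=> UD ru; have rg : ranked (range iota) by exact: iota_ranked.
have mem_g i y : vmem (vpair (iota i) y) g <-> D i /\ y = u i.
  rewrite mem_vfun_pair//; split=> [[j Dj [/iota_inj -> ->]]//|[Di ->]].
  by exists i.
pose c := push g (fun=> mkset (range u)).
have [y yC [xy yuniq]] : exists2 y, vmem y (star (mkset (range u))) &
   vmem (vpair x y) (star g) /\ forall q, vmem q (star g) -> forall a, vmem a q ->
    forall y', vmem y' a -> q = vpair x y' -> y' = y.
  have := @los_base (fun Z e => exists2 y, vmem y (e 2%N) &
   vmem (vpair (e 0%N) y) (e 1%N) /\ forall q, vmem q (e 1%N) -> forall a, vmem a q ->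
    forall y', vmem y' a -> q = vpair (e 0%N) y' -> y' = y) c.
  move=> /=[|_]; first by definable_tac.
  apply; apply: filterS UD => i Di; exists (u i); first by apply/(mem_mkset _ ru); exists i.
  split; first by apply/mem_g.
  by move=> q qg a aq y' ya qE; move: qg; rewrite qE => /mem_g[].
rewrite (vapp_eq xy yuniq); split=> // y' xy'.
apply: (yuniq _ xy' (mkset [set x; y'])) => //.
  by apply/mem_vpair; right.
by apply/mem_set2; right.
Qed.

Lemma los_on_vapp L D u : point_or_const `<=` L -> los_on L -> ultra D ->
  ranked (range u) -> los_on (L `|` [set (vapp (star (vfun D iota u)) x, u)]).
Proof.
set g := vfun D iota u => pL losL UD ru P dP e eL.
have [yC xy yuniq] := vfun_at UD ru.
pose nw i := `[<e i = (vapp (star g) x, u)>].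
have nwE i : nw i -> e i = (vapp (star g) x, u) by move/asboolP.
(* The point, the graph and its range come first; the places that held the new object receive x as a
   filler, so that only objects of L remain. *)
pose e' i := match i with 0%N => (x, iota) | 1%N => (star g, fun=> g)
   | 2%N => (star (mkset (range u)), fun=> mkset (range u))
   | j.+3 => if nw j then (x, iota) else e j end.
have e'L i : L (e' i).
  case: i => [|[|[|i]]] /=.
  - by apply: pL; left.
  - by apply: pL; right; exists g.
  - by apply: pL; right; exists (mkset (range u)).
  - case: ifPn => [_|nwi]; first by apply: pL; left.
    by have [//|ei] := eL i; case/negP: nwi; apply/asboolP.
(* The new object becomes the quantified variable 0; the other positions move by four, one place for
   that variable and three for the added parameters. *)
pose s i := if nw i then 0%N else i.+4.
pose Q : vpred := fun Z e => exists2 y, vmem y (e 2%N) &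
  vmem (vpair (e 0%N) y) (e 1%N) /\ P Z (push y e \o s).
have dQ : definable Q.
  apply: definable_ex2; apply: definable_and => /=; first by definable_tac.
  apply: definable_iff (definable_rename s dP) => Z d.
  suff -> // : push (d 0%N) (fun j => d j.+1) = d by [].
  by apply/funext => -[].
have E1 : (fun i => (e i).1) = push (vapp (star g) x) (fun i => (e' i).1) \o s.
  by apply/funext => i; rewrite /s /=; case: ifPn => [/nwE ->|nwi]//=; rewrite (negbTE nwi).
have E2 j : (fun i => (e i).2 j) = push (u j) (fun i => (e' i).2 j) \o s.
  by apply/funext => i; rewrite /s /=; case: ifPn => [/nwE ->|nwi]//=; rewrite (negbTE nwi).
have -> : P Y (fun i => (e i).1) <-> Q Y (fun i => (e' i).1).
  rewrite E1; split=> [PY|[y _ [/yuniq ->]]//].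
  by exists (vapp (star g) x).
rewrite (losL Q)//; split; apply: filterS2 UD => j Dj; rewrite /= E2.
  by move=> [y _ [/mem_vfun_pair[]// i Di [/iota_inj <- ->]]].
move=> PX; exists (u j); first by apply/(mem_mkset _ ru); exists j.
by split=> //; apply/mem_vfun_pair => //; exists j.
Qed.

(** The domain D may be any set of the ultrafilter, because the sequences of interest are partial:
    they start after k, and integrals of f exist only at some indices. *)
Definition represents (a : superstructure Y * (I -> superstructure X)) : Prop :=
  point_or_const a \/ exists D u, [/\ ultra D, ranked (range u) &
    a = (vapp (star (vfun D iota u)) x, u)].

Theorem los P (l : seq (superstructure Y * (I -> superstructure X))) :
  definable P -> (forall i, (i < size l)%N -> represents (nth (x, iota) l i)) ->
  P Y (fun i => (nth (x, iota) l i).1) <->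
  ultra [set j | P X (fun i => (nth (x, iota) l i).2 j)].
Proof.
move=> dP lrep.
(* Los's theorem is extended to one representable object at a time: such an
   object can be quantified away using the graph and the range of its sequence,
   which are constants. *)
suff [L [lL _ losL]] : exists L, [/\ forall i, L (nth (x, iota) l i),
    point_or_const `<=` L & los_on L] by exact: losL.
elim: l lrep {P dP} => [|a l IH] lrep.
  exists point_or_const; split=> //; last exact: los_on_point.
  by move=> i; rewrite nth_nil; left.
have [|L [lL pL losL]] := IH; first by move=> i il; exact: (lrep i.+1).
have [pa|[D [u [UD ru aE]]]] := lrep 0%N isT.
  by exists L; split=> // -[|i]//=; exact: pL.
exists (L `|` [set a]); split.
- by move=> [|i] /=; [right|left].
- by apply: subset_trans pL _; exact: subsetUl.
- by move: aE => /= ->; exact: los_on_vapp.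
Qed.

End point.
End los.

(** * Hyperreals and standard parts *)

Section hyperreals.
Context (R : realType) (d : measure_display) (E : measurableType d).
Context (X Y : Type) (b : base_embedding R E X).
Context (star : superstructure X -> superstructure Y).
Hypothesis hstar : nonstandard_extension star.

Lemma atom_inj (Z : Type) : injective (@atom Z).
Proof. by move=> y z yz; exact: (proj1 (@decode_eq Z 0 0 y z) yz). Qed.

Lemma ranked_atoms (Z I : Type) (D : set I) (g : I -> Z) :
  ranked [set atom (g i) | i in D].
Proof. by exists 0%N => _ [i _ <-]; exists (g i). Qed.

Lemma vreal_inj : injective (vreal b).
Proof. by move=> r s rs; apply: (@base_real_inj _ _ _ b); exact: atom_inj rs. Qed.

Lemma ranked_vreal : ranked (range (vreal b)).
Proof. exact: ranked_atoms. Qed.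

Let rpair (p : R * R) := vpair (vreal b p.1) (vreal b p.2).

Lemma rpair_inj : injective rpair.
Proof. by move=> [r s] [r2 s2] /vpair_inj[]/= /vreal_inj -> /vreal_inj ->. Qed.

Lemma ranked_rpair : ranked (range rpair).
Proof. by apply: ranked_pairs; exact: ranked_atoms. Qed.

Local Notation hyper x := (ultra star (vreal b) x).

(** Subtraction is a graph over pairs, so its value is obtained from [vfun_at] with the pair itself
    as the point; this puts the pair in the extension of the set of pairs. *)
Let vpair_hyper x r : hyper x setT -> ultra star rpair (vpair x (star (vreal b r))) setT.
Proof.
move=> xR; pose c := push (vreal b r) (fun=> mkset (range rpair)).
have := @los_all _ _ _ hstar _ _ _ vreal_inj ranked_vreal xR
  (fun Z e => exists2 q, vmem q (e 2%N) & q = vpair (e 0%N) (e 1%N)) c.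
case=> [|y|q qR /= <- //]; first by definable_tac.
exists (rpair (y, r)) => //.
by apply/(mem_mkset _ ranked_rpair); exists (y, r).
Qed.

Lemma star_sub (c c' : superstructure X) a :
  (forall y, vmem y c -> vmem y c') -> vmem a (star c) -> vmem a (star c').
Proof.
move=> cc'; have := transfer hstar (fun i => if i is 0%N then c else c')
  (P := fun Z e => forall y, vmem y (e 0%N) -> vmem y (e 1%N)).
by move=> /(_ _)[|/(_ cc') + _]; [definable_tac|exact].
Qed.

Lemma hyper_sub (D : set (superstructure X)) a :
  D `<=` range (vreal b) -> vmem a (star (mkset D)) -> hyper a setT.
Proof.
move=> DR; apply: star_sub => y /mem_mkset -/(_ (ranked_sub DR ranked_vreal)) /DR yR.
by apply/(mem_mkset _ ranked_vreal).
Qed.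

Let vnorm_at s : hyper s setT ->
  hyper (hnorm b star s) setT /\ vmem (vpair s (hnorm b star s)) (star (vnorm b)).
Proof.
move=> sR; have [|tR st _] := vfun_at hstar vreal_inj ranked_vreal sR
  (u := fun r => vreal b `|r|) sR.
  exact: ranked_atoms.
by split=> //; apply: hyper_sub tR => _ [r _ <-]; exists `|r|.
Qed.

Let vsub_at x r : hyper x setT -> hyper (hsub b star x (star (vreal b r))) setT /\
  vmem (vpair (vpair x (star (vreal b r))) (hsub b star x (star (vreal b r))))
    (star (vsub b)).
Proof.
move=> /vpair_hyper -/(_ r) qR.
have [|tR st _] := vfun_at hstar rpair_inj ranked_rpair qR
  (u := fun p => vreal b (p.1 - p.2)) qR.
  exact: ranked_atoms.
by split=> //; apply: hyper_sub tR => _ [p _ <-]; exists (p.1 - p.2).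
Qed.

Lemma mem_vle r s : vmem (vpair (vreal b r) (vreal b s)) (vle b) <-> r <= s.
Proof.
rewrite mem_mkset; last by apply: (ranked_sub _ ranked_rpair) => _ [p _ <-]; exists p.
split=> [[p /= rs /vpair_inj[/vreal_inj <- /vreal_inj <-]]//|rs].
by exists (r, s).
Qed.

Lemma mem_vnorm r s : vmem (vpair (vreal b r) (vreal b s)) (vnorm b) <-> s = `|r|.
Proof.
rewrite mem_vfun_pair; [|exact: ranked_vreal|exact: ranked_atoms].
by split=> [[i _ [/vreal_inj -> /vreal_inj ->]]//|->]; exists r.
Qed.

Lemma mem_vsub r s t :
  vmem (vpair (vpair (vreal b r) (vreal b s)) (vreal b t)) (vsub b) <-> t = r - s.
Proof.
rewrite mem_vfun_pair; [|exact: ranked_rpair|exact: ranked_atoms].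
split=> [[i _ [/vpair_inj[/vreal_inj -> /vreal_inj ->] /vreal_inj ->]]//|->].
by exists (r, s).
Qed.

(** This lemma and its analogue for [hsub] replace the internal order, norm and subtraction by
    membership of sets of reals in the ultrafilter of x. Finiteness and closeness are handled in
    that form afterwards. *)
Lemma hle_hnorm x m : hyper x setT ->
  hle b star (hnorm b star x) (star (vreal b m)) <-> hyper x [set y : R | `|y| <= m].
Proof.
move=> xR; set A := [set y | _].
(* Variable 0 is the point x, so entry i of the list is variable i+1 of the formula. *)
pose c i := nth (vreal b m) [:: vreal b m; vnorm b; vle b; vR b; mkset (vreal b @` A)] i.
have [tR xt] := vnorm_at xR.
have := @los_all _ _ _ hstar _ _ _ vreal_inj ranked_vreal xR
  (fun Z e => forall t, vmem t (e 4%N) -> vmem (vpair (e 0%N) t) (e 2%N) ->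
     (vmem (vpair t (e 1%N)) (e 3%N) <-> vmem (e 0%N) (e 5%N))) c.
move=> H; apply: H tR xt; first by definable_tac.
move=> y /= _ /(mem_mkset _ ranked_vreal)[t _ <-] /mem_vnorm ->.
by rewrite mem_vle (mem_mkset_image vreal_inj ranked_vreal).
Qed.

Lemma hle_hnorm_hsub x r m : hyper x setT ->
  hle b star (hnorm b star (hsub b star x (star (vreal b r)))) (star (vreal b m)) <->
  hyper x [set y : R | `|y - r| <= m].
Proof.
move=> xR; set A := [set y | _].
pose c i := nth (vreal b m) [:: vreal b m; vnorm b; vle b; vR b; mkset (vreal b @` A);
  vsub b; vreal b r; mkset (range rpair)] i.
have [sR xs] := vsub_at r xR; have [tR st] := vnorm_at sR.
have := @los_all _ _ _ hstar _ _ _ vreal_inj ranked_vreal xR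
  (fun Z e => forall s, vmem s (e 4%N) ->
     (exists2 q, vmem q (e 8%N) & q = vpair (e 0%N) (e 7%N) /\ vmem (vpair q s) (e 6%N)) ->
     forall t, vmem t (e 4%N) -> vmem (vpair s t) (e 2%N) ->
     (vmem (vpair t (e 1%N)) (e 3%N) <-> vmem (e 0%N) (e 5%N))) c.
move=> H; apply: H sR _ _ tR st; first by definable_tac.
  move=> y /= s /(mem_mkset _ ranked_vreal)[s' _ <-] [q _ [->]] /mem_vsub -> t.
  move=> /(mem_mkset _ ranked_vreal)[t' _ <-] /mem_vnorm ->.
  by rewrite mem_vle (mem_mkset_image vreal_inj ranked_vreal).
by exists (vpair x (star (vreal b r))) => //; exact: vpair_hyper.
Qed.

Lemma hyper_near_unique x r s : hyper x setT ->
  (forall e : R, 0 < e -> hyper x [set y : R | `|y - r| <= e]) ->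
  (forall e : R, 0 < e -> hyper x [set y : R | `|y - s| <= e]) -> r = s.
Proof.
move=> xR xr xs; have UF := ultra_filter hstar vreal_inj ranked_vreal xR.
apply/eqP; rewrite -subr_eq0 -normr_le0; apply/ler_addgt0Pl => e e0.
have e2 : 0 < e / 2 by rewrite divr_gt0.
have [y [yr ys]] := filter_ex (filterI (xr _ e2) (xs _ e2)).
rewrite addr0 (_ : r - s = (y - s) - (y - r)); last by rewrite opprB [RHS]addrC addrA subrK.
by rewrite (le_trans (ler_normB _ _))// (splitr e) lerD.
Qed.

Lemma st_near x r : hyper x setT -> (forall e : R, 0 < e -> hyper x [set y : R | `|y - r| <= e]) ->
  finite_hyperreal b star x /\ st b star x = r.
Proof.
move=> xR xr; have UF := ultra_filter hstar vreal_inj ranked_vreal xR.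
have fx : finite_hyperreal b star x.
  split=> //; have [m rm] : exists m : nat, `|r| + 1 <= m%:R.
    by exists (Num.bound (`|r| + 1)); apply/ltW/archi_boundP; rewrite addr_ge0.
  exists m; apply/hle_hnorm => //; have := xr 1 ltr01; apply: filterS => y yr.
  apply: le_trans rm; rewrite -lerBlDl; apply: le_trans yr; exact: lerB_dist.
split=> //; have : [set s | finite_hyperreal b star x /\
    infinitely_close b star x (star (vreal b s))] (st b star x).
  apply: xgetPex; exists r; split=> // e e0; apply/hle_hnorm_hsub => //.
  exact: xr.
move=> [_ xst]; apply: (hyper_near_unique xR) => // e e0.
by apply/hle_hnorm_hsub => //; exact: xst.
Qed.

(** The standard part is the supremum of the reals a with *a <= x, a set that finiteness of x
    bounds. Some such a exceeds the supremum minus e, while the supremum plus e is not among them;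
    as the filter is ultra, x lies below it. *)
Lemma finite_near_st x : finite_hyperreal b star x ->
  forall e : R, 0 < e -> hyper x [set y : R | `|y - st b star x| <= e].
Proof.
move=> [xR [m]] /hle_hnorm -/(_ xR) xm.
have UF := ultra_filter hstar vreal_inj ranked_vreal xR.
pose S := [set a | hyper x [set y : R | a <= y]].
have Sub : ubound S m%:R.
  move=> a aS; have [y [/= ym ay]] := filter_ex (filterI xm aS).
  by rewrite (le_trans ay)// (le_trans (ler_norm _)).
have hS : has_sup S.
  split; last by exists m%:R.
  by exists (- m%:R); apply: filterS xm => y /=; rewrite ler_norml => /andP[].
suff xr (e : R) : 0 < e -> hyper x [set y : R | `|y - sup S| <= e].
  by have [_ ->] := st_near xR xr.
move=> e0; have [a aS aE] := sup_adherent e0 hS.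
have [xe|xe] := ultraC hstar vreal_inj ranked_vreal xR [set y | sup S + e <= y].
  by have := sup_upper_bound hS xe; rewrite gerDl leNgt e0.
have {}aS : hyper x [set y : R | a <= y] := aS.
apply: filterS (filterI aS xe) => y [/= ay] /negP; rewrite -ltNge => ye.
rewrite ler_distl (ltW ye) andbT; exact/ltW/(lt_le_trans aE).
Qed.

End hyperreals.

(** * Finitely additive measures on compact algebras *)

Section compact_algebra.
Context (T : pointedType) (R : realType) (G : set (set T)) (m : set T -> R).
Hypothesis G0 : G set0.
Hypothesis GU : setU_closed G.
Hypothesis GC : setC_closed G.

(* The closure proofs are arguments of the type so that its instance can use them. *)
Definition algebra_type of G set0 & setU_closed G & setC_closed G : Type := T.
Local Notation aT := (algebra_type G0 GU GC).
HB.instance Definition _ := Pointed.on aT.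
HB.instance Definition _ := @isAlgebraOfSets.Build default_measure_display aT G G0 GU GC.

Hypothesis m_ge0 : forall A, G A -> 0 <= m A.
Hypothesis mU : forall A B, G A -> G B -> A `&` B = set0 -> m (A `|` B) = m A + m B.
Hypothesis G_compact : forall F : nat -> set T, (forall i, G (F i)) ->
  (forall n, exists x, forall i, (i <= n)%N -> F i x) -> exists x, forall i, F i x.

(** The value 0 outside G keeps the function nonnegative on every set, where nothing is known of
    m. *)
Definition algebra_measure (A : set aT) : \bar R :=
  if `[<G A>] then (m A)%:E else 0%E.
Local Notation mu := algebra_measure.

Let m0 : m set0 = 0.
Proof.
have := mU G0 G0 (set0I _); rewrite set0U => E.
by apply: (@addrI _ (m set0)); rewrite -E addr0.
Qed.

Let muE A : G A -> mu A = (m A)%:E.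
Proof. by move=> GA; rewrite /mu asboolT. Qed.

Let mu0 : mu set0 = 0%E. Proof. by rewrite muE// m0. Qed.

Let mu_ge0 A : (0 <= mu A)%E.
Proof. by rewrite /mu; case: asboolP => // /m_ge0. Qed.

Let mu_finite (F : nat -> set aT) n : (forall i, G (F i)) -> trivIset setT F ->
  G (\big[setU/set0]_(i < n) F i) /\
  mu (\big[setU/set0]_(i < n) F i) = (\sum_(i < n) mu (F i))%E.
Proof.
move=> GF tF; elim: n => [|n [IHG IH]]; first by rewrite !big_ord0.
rewrite !big_ord_recr/= -IH; split; first exact: GU.
rewrite !muE//; last exact: GU.
rewrite mU//; rewrite (@trivIset_bigsetUI _ xpredT)//.
by rewrite [X in trivIset X F](_ : _ = setT)//; exact/seteqP.
Qed.

Let mu_sigma_additive : semi_sigma_additive mu.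
Proof.
move=> F GF tF GUF.
pose U n := \big[setU/set0]_(i < n) F i.
(* The remainders D n decrease within G. If none were empty, compactness would give a point of the
   union that lies in no partial union. *)
pose D n := (\bigcup_i F i) `&` ~` U n.
have GD n : G (D n).
  rewrite /D -(setCK (\bigcup_i F i)) -setCU; apply: GC; apply: GU; first exact: GC.
  exact: (mu_finite n GF tF).1.
have [n Dn0] : exists n, D n = set0.
  apply: contrapT => nD.
  have [n|x Dx] := G_compact GD.
    have : D n != set0 by apply/eqP => Dn0; apply: nD; exists n.
    move=> /set0P[x [Fx Ux]]; exists x => i ni; split=> // Uix; apply: Ux.
    by move: x Uix {Fx}; apply: subset_bigsetU.
  have [[i _ Fix] _] := Dx 0%N; have [_] := Dx i.+1; apply.
  by rewrite /U big_ord_recr /=; right.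
have UE k : (n <= k)%N -> U k = \bigcup_i F i.
  move=> nk; apply/seteqP; split.
    exact: bigsetU_bigcup.
  move=> x Fx; apply: contrapT => Ux; have : D n x.
    by split=> // Uix; apply: Ux; move: x Uix {Fx}; exact: subset_bigsetU.
  by rewrite Dn0.
apply: cvg_near_cst; exists n => // k /= nk.
by rewrite big_mkord -(mu_finite k GF tF).2 -/(U k) UE.
Qed.

HB.instance Definition _ := isMeasure.Build _ _ _ mu mu0 mu_ge0 mu_sigma_additive.

(** The Caratheodory extension, retyped on the sigma-algebra generated by G, which is the space over
    which [extends_st] takes its measures. *)
Definition algebra_extension (A : set (g_sigma_algebraType G)) : \bar R :=
  measure_extension mu A.

Let extension0 : algebra_extension set0 = 0%E.
Proof. exact: (@measure0 _ _ _ (measure_extension mu)). Qed.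

Let extension_ge0 A : (0 <= algebra_extension A)%E.
Proof. exact: (@measure_ge0 _ _ _ (measure_extension mu)). Qed.

Let extension_sigma_additive : semi_sigma_additive algebra_extension.
Proof. exact: (@measure_semi_sigma_additive _ _ _ (measure_extension mu)). Qed.

HB.instance Definition _ := isMeasure.Build _ _ _ algebra_extension
  extension0 extension_ge0 extension_sigma_additive.

Lemma compact_algebra_extension :
  exists lam : {measure set (g_sigma_algebraType G) -> \bar R},
    forall A, G A -> lam A = (m A)%:E.
Proof.
exists algebra_extension => A GA.
by rewrite /= /algebra_extension /measure_extension measurable_mu_extE//; exact: muE.
Qed.

End compact_algebra.

(** * Integration along a filter *)

Section finite_measure_integral.
Context d (T : measurableType d) (R : realType) (mu : {measure set T -> \bar R}).
Hypothesis mu_fin : (mu setT < +oo)%E.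

Lemma bounded_integrable (u : T -> R) (M : R) : measurable_fun setT u ->
  (forall x, `|u x| <= M) -> mu.-integrable setT (EFin \o u).
Proof.
move=> mu_ uM; apply: measurable_bounded_integrable => //.
exists M; split; first exact: num_real.
by move=> N MN x _; exact: le_trans (uM x) (ltW MN).
Qed.

Lemma norm_Rintegral_le (u : T -> R) (e : R) : 0 <= e ->
  mu.-integrable setT (EFin \o u) -> (\forall x \ae mu, `|u x| <= e) ->
  `|\int[mu]_x u x| <= e * fine (mu setT).
Proof.
move=> e0 iu ue; have /integrableP[mu_ _] := iu.
have muf : mu setT \is a fin_num by rewrite ge0_fin_numE.
rewrite -lee_fin EFinM fineK// EFin_normr_Rintegral//.
apply: le_trans (le_abse_integral _ measurableT mu_) _.
rewrite -integral_cst//; apply: ae_ge0_le_integral => //.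
- exact: measurableT_comp.
- by apply: filterS ue => x ux _ /=; rewrite lee_fin.
Qed.

Lemma step_integral (Z : nat -> set T) (c : nat -> R) n :
  (forall i, measurable (Z i)) ->
  mu.-integrable setT (fun x => (\sum_(i < n) c i * \1_(Z i) x)%:E) /\
  \int[mu]_x (\sum_(i < n) c i * \1_(Z i) x) = \sum_(i < n) c i * fine (mu (Z i)).
Proof.
move=> mZ; have ic i : mu.-integrable setT (EFin \o (fun x => c i * \1_(Z i) x)).
  apply: (@bounded_integrable _ `|c i|).
    by apply: measurable_funM => //; exact: measurable_indic.
  move=> x; rewrite normrM -[leRHS]mulr1 ler_wpM2l// indicE.
  by case: (_ \in _); rewrite ?normr1 ?normr0.
have iZ i : mu.-integrable setT (EFin \o \1_(Z i)).
  apply: (@bounded_integrable _ 1); first exact: measurable_indic.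
  by move=> x; rewrite indicE; case: (_ \in _); rewrite ?normr1 ?normr0.
elim: n => [|n [IH1 IH2]].
  split.
    apply: (eq_integrable measurableT (cst 0%E)); last exact: integrable0.
    by move=> x _; rewrite big_ord0.
  under eq_Rintegral do rewrite big_ord0.
  by rewrite big_ord0 Rintegral_cst// mul0r.
split.
  apply: (eq_integrable measurableT (fun x => (\sum_(i < n) c i * \1_(Z i) x)%:E +
    (c n * \1_(Z n) x)%:E)%E); last exact: integrableD (ic n).
  by move=> x _; rewrite big_ord_recr.
under eq_Rintegral do rewrite big_ord_recr/=.
rewrite big_ord_recr/= -IH2 RintegralD//.
congr (_ + _); rewrite RintegralZl//.
by rewrite /Rintegral integral_indic// setIT.
Qed.

(** The comparison is with the step function equal to c i on Z i; disjointness leaves a single term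
    of the sum at a covered point. The covering is required only almost everywhere, since on the
    Loeb side the approximation is available only where *f is finite. *)
Lemma partition_integral (u : T -> R) (M : R) (Z : nat -> set T) (c : nat -> R) n (e : R) :
  measurable_fun setT u -> (forall x, `|u x| <= M) -> (forall i, measurable (Z i)) ->
  (forall i j x, Z i x -> Z j x -> i = j) -> 0 <= e ->
  (\forall x \ae mu, exists i, [/\ (i < n)%N, Z i x & `|u x - c i| <= e]) ->
  `|\int[mu]_x u x - \sum_(i < n) c i * fine (mu (Z i))| <= e * fine (mu setT).
Proof.
move=> mu_ uM mZ dZ e0 Zu; have [is1 <-] := step_integral c n mZ.
have iu := bounded_integrable mu_ uM.
rewrite -RintegralB//; apply: norm_Rintegral_le => //.
  exact: (integrableB measurableT iu is1).
apply: filterS Zu => x [i [ni Zi ui]].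
suff -> : \sum_(j < n) c j * \1_(Z j) x = c i by [].
rewrite (bigD1 (Ordinal ni))//= indicE mem_set// mulr1 big1 ?addr0// => j ji.
rewrite indicE memNset ?mulr0// => Zj; case/negP: ji; apply/eqP/val_inj.
exact: dZ Zj Zi.
Qed.

End finite_measure_integral.

(** * Truncation of reals at height m *)

Section truncation.
Context (R : realType).
Implicit Types (m y z : R).

Definition clip m y : R := Num.max (- m) (Num.min m y).

Lemma clip_bounded m y : 0 <= m -> `|clip m y| <= m.
Proof.
move=> m0; rewrite /clip ler_norml le_max lexx/= ge_max ge_min lexx/= andbT.
by rewrite ge0_cp.
Qed.

Lemma max_lip m y z : `|Num.max m y - Num.max m z| <= `|y - z|.
Proof.
have := ler_norm (y - z); have := ler_norm (- (y - z)); rewrite normrN.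
rewrite (ler_norml (_ - _)) /Num.max.
by move: `|y - z| => a; case: (ltP m y) => my; case: (ltP m z) => mz; lra.
Qed.

Lemma min_lip m y z : `|Num.min m y - Num.min m z| <= `|y - z|.
Proof.
have := ler_norm (y - z); have := ler_norm (- (y - z)); rewrite normrN.
rewrite (ler_norml (_ - _)) /Num.min.
by move: `|y - z| => a; case: (ltP m y) => my; case: (ltP m z) => mz; lra.
Qed.

Lemma clip_lip m y z : `|clip m y - clip m z| <= `|y - z|.
Proof. exact: le_trans (max_lip _ _ _) (min_lip _ _ _). Qed.

Lemma clip_id m y : `|y| < m -> clip m y = y.
Proof.
by move=> /ltr_normlP[y1 y2]; rewrite /clip min_r ?max_r//; lra.
Qed.

Lemma clip_norm m y : 0 <= m -> `|clip m y| <= `|y|.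
Proof.
move=> m0; have := clip_lip m y 0; rewrite subr0 [in X in X -> _](_ : clip m 0 = 0) ?subr0//.
by rewrite /clip min_r// max_r// oppr_le0.
Qed.

(** Together with [clip_id] this bounds the truncation error pointwise by the integrand of the tail
    at m. *)
Lemma clip_error m y : 0 <= m -> `|y - clip m y| <= `|y|.
Proof.
move=> m0; have := ler_norm y; have := ler_norm (- y); rewrite normrN ler_norml.
rewrite /clip /Num.max /Num.min; move: `|y| => a.
by case: (ltP m y) => my; [case: (ltP (- m) m)|case: (ltP (- m) y)] => h1; lra.
Qed.

Lemma measurable_clip m : measurable_fun setT (clip m).
Proof.
by apply: measurable_maxr => //; exact: measurable_minr.
Qed.

Lemma minnorm_lip m y z : `|Num.min m `|y| - Num.min m `|z| | <= `|y - z|.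
Proof.
exact: le_trans (min_lip _ _ _) (ler_dist_dist y z).
Qed.

End truncation.

(** * Tail integrals on a space of mass 1 *)

Section tails.
Context d (T : measurableType d) (R : realType) (mu : {measure set T -> \bar R}).
Hypothesis mu1 : mu setT = 1%E.
Variable g : T -> R.
Hypothesis mg : measurable_fun setT g.

Local Notation tail m := (\int[mu]_(x in [set x | (m <= `|g x|)%R]) `|g x|%:E)%E.

Let measurable_tail (m : R) : measurable [set x | m <= `|g x|].
Proof.
rewrite -[X in measurable X]setTI; apply: measurable_fun_le => //.
exact: measurableT_comp.
Qed.

Let tailE (m : R) : tail m = (\int[mu]_x ((fun x => `|g x|%:E) \_ [set x | (m <= `|g x|)%R]) x)%E.
Proof. by rewrite integral_mkcond. Qed.

Let measurable_tail_fun (m : R) :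
  measurable_fun setT ((fun x => `|g x|%:E) \_ [set x | m <= `|g x|]).
Proof.
apply/(measurable_restrictT _ (measurable_tail m)).
apply: measurable_funTS; apply/measurable_EFinP; exact: measurableT_comp.
Qed.

Let tail_fun_ge0 (m : R) x : (0 <= ((fun x => `|g x|%:E) \_ [set x | (m <= `|g x|)%R]) x)%E.
Proof. by rewrite patchE; case: ifP. Qed.

(** Pointwise |g| is at most m plus the tail integrand, and the space has mass 1. *)
Lemma integral_norm_le_tail (m : R) : 0 <= m -> (\int[mu]_x `|g x|%:E <= m%:E + tail m)%E.
Proof.
move=> m0; rewrite tailE.
have <- : (\int[mu]_x (cst m%:E x) = m%:E)%E.
  by rewrite integral_cst// mu1 mule1.
rewrite -ge0_integralD//.
apply: ge0_le_integral => //.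
- apply/measurable_EFinP; exact: measurableT_comp.
- exact: emeasurable_funD.
move=> x _; rewrite patchE; case: ifPn => [_|]; first by rewrite /= leeDr// lee_fin.
by rewrite notin_setE /= => /negP; rewrite -ltNge adde0 lee_fin => /ltW.
Qed.

Lemma tail_integrable (m : R) : 0 <= m -> (tail m < +oo)%E ->
  mu.-integrable setT (EFin \o g).
Proof.
move=> m0 tm; apply/integrableP; split; first exact/measurable_EFinP.
by apply: le_lt_trans (integral_norm_le_tail m0) _; rewrite lte_add_pinfty ?ltry.
Qed.

Lemma clip_integral_error (m e : R) : 0 <= m -> mu.-integrable setT (EFin \o g) ->
  (tail m <= e%:E)%E -> `|\int[mu]_x g x - \int[mu]_x clip m (g x)| <= e.
Proof.
move=> m0 ig tm.
have mu_fin : (mu setT < +oo)%E by rewrite mu1 ltry.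
have mc : measurable_fun setT (clip m \o g).
  by apply: measurableT_comp mg; exact: measurable_clip.
have ic : mu.-integrable setT (EFin \o (clip m \o g)).
  by apply: (bounded_integrable mu_fin mc (M := m)) => x; exact: clip_bounded.
rewrite -RintegralB// -lee_fin EFin_normr_Rintegral//; last exact: (integrableB measurableT ig ic).
apply: le_trans (le_abse_integral _ measurableT _) _.
  by apply/measurable_EFinP; exact: measurable_funB.
apply: le_trans tm; rewrite tailE; apply: ge0_le_integral => //.
- apply: measurableT_comp => //; apply/measurable_EFinP; exact: measurable_funB.
move=> x _; rewrite patchE; case: ifPn => [_|]; first by rewrite lee_fin clip_error.
rewrite notin_setE /= => /negP; rewrite -ltNge => gm.
by rewrite clip_id// subrr normr0.
Qed.

End tails.

(** * Passing to the limit in the integrals by means of ultrafilters of values *)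

Section limit_integral.
Context (R : realType) (F : set_system nat) {FF : ProperFilter F}.
Context (dn : nat -> measure_display) (S : forall n, measurableType (dn n)).
Context (nu : forall n, probability (S n) R) (g : forall n, S n -> R).
Hypothesis mg : forall n, measurable_fun setT (@g n).
Context d (T : measurableType d) (mu : {measure set T -> \bar R}).
Context (W : T -> set_system R) (h : T -> R).
Hypothesis mu1 : mu setT = 1%E.
(* [W x] is an ultrafilter, converging to [h x] if it contains a bounded set; the
   sets [W^-1 A] are the analogues in T of the sets [g n @^-1` A]. *)
Hypothesis WF : forall x, ProperFilter (W x).
Hypothesis WC : forall x A, W x A \/ W x (~` A).
Hypothesis mW : forall A, measurable A -> measurable [set x | W x A].
Hypothesis muW : forall A, measurable A ->
  fine (nu n (@g n @^-1` A)) @[n --> F] --> fine (mu [set x | W x A]).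

(** In the application these are the points where *f is finite. *)
Definition bounded_part : set T := \bigcup_m [set x | W x [set y : R | `|y| <= m%:R]].

Hypothesis W_near : forall x, bounded_part x ->
  forall e : R, 0 < e -> W x [set y : R | `|y - h x| <= e].
Hypothesis h_out : forall x, ~ bounded_part x -> h x = 0.
Hypothesis tails : forall e : R, 0 < e -> exists m0 : nat, forall m, (m0 <= m)%N ->
  \forall n \near F,
    (\int[nu n]_(x in [set x | (m%:R <= `|g x|)%R]) `|g x|%:E <= e%:E)%E.

Let mu_fin : (mu setT < +oo)%E. Proof. by rewrite mu1 ltry. Qed.

Let WS x (A B : set R) : A `<=` B -> W x A -> W x B.
Proof. exact: filterS. Qed.

(** If no cell belonged to the ultrafilter W x, all their complements would, and hence so would
    their intersection, which is empty. *)
Let W_cover x (A : nat -> set R) n : (forall y, exists2 i, (i < n)%N & A i y) ->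
  exists2 i, (i < n)%N & W x (A i).
Proof.
move=> cA; apply: contrapT => nW.
suff /filter_ex[y yA] : W x [set y | forall i, (i < n)%N -> ~ A i y].
  by have [i ni Ai] := cA y; exact: yA ni Ai.
have {}nW i : (i < n)%N -> ~ W x (A i) by move=> ni Wi; apply: nW; exists i.
elim: n nW {cA} => [|n IH] nW; first by apply: filterE => y i.
have WA : W x (~` A n) by have [/(nW n (ltnSn n))|] := WC x (A n).
have Wn := IH (fun i ni => nW i (ltnW ni)).
apply: filterS (filterI WA Wn) => y [yn yA] i.
by rewrite ltnS leq_eqVlt => /predU1P[->//|]; exact: yA.
Qed.

Let measurable_le_norm (m : R) : measurable [set y : R | `|y| <= m].
Proof.
rewrite -[X in measurable X]setTI; apply: measurable_fun_le => //.
Qed.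

Let measurable_bounded_part : measurable bounded_part.
Proof. by apply: bigcupT_measurable => m; exact: mW. Qed.

(** This writes a strict level set of h as a countable union of sets [W^-1 A]. The gap 1/(j+1) is
    needed because values above a alone only give h x >= a in the limit. *)
Let h_gt x (a : R) : bounded_part x ->
  (a < h x) <-> exists j : nat, W x [set y : R | a + j.+1%:R^-1 <= y].
Proof.
move=> bx; split=> [ah|[j Wj]].
  have ha2 : 0 < (h x - a) / 2 by rewrite divr_gt0// subr_gt0.
  have [j] := ltr_add_invr ha2; rewrite add0r => hj.
  exists j; apply: WS (W_near bx ha2) => y /=; rewrite ler_distl => /andP[+ _].
  by move: (j.+1%:R^-1) hj => i hj hy; lra.
have j0 : 0 < (j.+1%:R^-1 : R) / 2 by rewrite divr_gt0.
have [y [/= y1]] := filter_ex (filterI Wj (W_near bx j0)).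
rewrite ler_distl => /andP[_]; have : 0 < (j.+1%:R^-1 : R) by rewrite invr_gt0.
by move: (j.+1%:R^-1) j0 y1 => i; lra.
Qed.

Let measurable_h : measurable_fun setT h.
Proof.
apply: (measurability _ (RGenOInfty.measurableE R)) => //.
move=> /= _ [_ [a ->] <-]; rewrite setTI.
(* Outside [bounded_part] the value of h is 0, so there the level set is everything or nothing
   according to the sign of a. *)
have -> : h @^-1` `]a, +oo[%classic =
    (bounded_part `&` \bigcup_j [set x | W x [set y : R | a + j.+1%:R^-1 <= y]]) `|`
    (~` bounded_part `&` [set x | a < 0]).
  apply/seteqP; split=> x /=; rewrite in_itv/= andbT.
    have [bx|bx] := pselect (bounded_part x).
      by move=> /(h_gt _ bx)[j Wj]; left; split=> //; exists j.
    by rewrite (h_out bx); right.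
  move=> [[bx [j _ Wj]]|[bx]]; first by apply/h_gt => //; exists j.
  by rewrite (h_out bx).
apply: measurableU; apply: measurableI => //.
- apply: bigcupT_measurable => j; apply: mW.
  by rewrite -[X in measurable X]setTI; apply: measurable_fun_le.
- exact: measurableC.
- by have [a0|a0] := pselect (a < 0);
    [rewrite (_ : [set x | _] = setT)//|rewrite (_ : [set x | _] = set0)//];
    apply/seteqP; split.
Qed.

Let fin_muW A : measurable A -> mu [set x | W x A] = (fine (mu [set x | W x A]))%:E.
Proof.
move=> mA; rewrite fineK// ge0_fin_numE// (le_lt_trans _ mu_fin)//.
by apply: le_measure; rewrite ?inE//; exact: mW.
Qed.

(** At an unbounded point, W x contains {|y| >= m} for every m. The measure of the set of such x is
    the limit of nu_n(|g| >= m), which Markov's inequality bounds by the tail integral. *)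
Let bounded_part_ae : \forall x \ae mu, bounded_part x.
Proof.
exists (~` bounded_part); split=> //; first exact: measurableC.
apply/eqP; rewrite eq_le measure_ge0 andbT; apply/lee_addgt0Pr => /=.
suff H (e : R) : 0 < e -> (mu (~` bounded_part) <= e%:E)%E by move=> e e0; rewrite add0e H.
move=> e0; have e2 : 0 < e / 2 by rewrite divr_gt0.
have [m0 Hm0] := tails e2.
(* With m >= 1 the integrand |g| is at least 1 on {|g| >= m}, so the tail integral dominates the
   measure of that set. *)
pose m := maxn m0 1; pose A := [set y : R | m%:R <= `|y|].
have mA : measurable A.
  rewrite -[A]setTI; apply: measurable_fun_le => //.
apply: (@le_trans _ _ (mu [set x | W x A])).
  apply: le_measure; rewrite ?inE; [exact: measurableC|exact: mW|].
  move=> x bx; have [//|WA] := WC x A; exfalso; apply: bx; exists m => //=.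
  by apply: WS WA => y /= /negP; rewrite -ltNge => /ltW.
rewrite fin_muW// lee_fin.
have /cvgrPdist_le cA := muW mA.
have [n [H1 H2]] := filter_ex (filterI (cA _ e2) (Hm0 m (leq_maxl _ _))).
rewrite -(subrK (fine (nu n (@g n @^-1` A))) (fine (mu _))) (splitr e).
apply: lerD; first by rewrite (le_trans (ler_norm _)).
have mgA : measurable (@g n @^-1` A) by rewrite -[X in measurable X]setTI; exact: mg.
rewrite -lee_fin fineK ?fin_num_measure//; apply: le_trans H2.
rewrite -[leLHS]mul1e -integral_cst//; apply: ge0_le_integral => //.
- by apply: measurable_funTS; apply/measurable_EFinP; exact: measurableT_comp.
- move=> x /= mx; rewrite lee_fin (le_trans _ mx)// ler1n; exact: leq_maxr.
Qed.

Let lip_limit (phi : R -> R) (M : R) : measurable_fun setT phi ->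
  (forall y, `|phi y| <= M) -> (forall y z, `|phi y - phi z| <= `|y - z|) ->
  (\int[nu n]_x phi (g x)) @[n --> F] --> \int[mu]_x phi (h x).
Proof.
move=> mphi phiM phi_lip.
have M0 : 0 <= M := le_trans (normr_ge0 _) (phiM 0).
apply/cvgrPdist_le => e e0.
(* Each of the two step functions costs 2 * dl, and the convergence of the finite sums one more
   dl. *)
pose dl : R := e / 5; have dl0 : 0 < dl by rewrite divr_gt0.
pose c (i : nat) : R := i%:R * dl - M.
pose A (i : nat) := phi @^-1` `[c i, c i + dl[%classic.
have AE i y : A i y <-> c i <= phi y < c i + dl.
  by rewrite /A /= in_itv.
(* So many intervals of length dl, starting at -M, cover [-M, M]. *)
pose K := (Num.truncn (2 * M / dl)).+1.
have cover y : exists2 i, (i < K)%N & A i y.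
  have /andP[p1 p2] : - M <= phi y <= M by rewrite -ler_norml.
  have t0 : 0 <= (phi y + M) / dl by apply: divr_ge0; [lra|exact: ltW].
  have /andP[t1 t2] := truncn_itv t0.
  exists (Num.truncn ((phi y + M) / dl)).
    rewrite ltnS; apply: le_truncn; rewrite ler_pM2r ?invr_gt0//; lra.
  rewrite AE /c; rewrite ler_pdivlMr// in t1; rewrite ltr_pdivrMr// -natr1 mulrDl mul1r in t2.
  by move: (_ * dl) t1 t2 => a; lra.
have mA i : measurable (A i).
  by rewrite -[A i]setTI; apply: mphi.
have dA i j y : A i y -> A j y -> i = j.
  wlog ij : i j / (i < j)%N => [H Ai Aj|].
    by have [/H->|/H ->|] := ltngtP i j.
  rewrite !AE /c => /andP[_ a2] /andP[a3 _].
  have : i.+1%:R * dl <= j%:R * dl by rewrite ler_pM2r// ler_nat.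
  rewrite -natr1 mulrDl mul1r; move: (i%:R * dl) (j%:R * dl) a2 a3 => a a' *; exfalso; lra.
(* A point y in the cell and within dl of h x gives one dl for the width of the cell and one, by the
   Lipschitz bound, for replacing h x by y. *)
have phi_h x i : bounded_part x -> W x (A i) -> `|phi (h x) - c i| <= 2 * dl.
  move=> bx Wi; have [y [/= /AE/andP[a1 a2] ay]] := filter_ex (filterI Wi (W_near bx dl0)).
  have := le_trans (phi_lip y (h x)) ay; rewrite !ler_norml => /andP[]; lra.
have dl2 : 0 <= 2 * dl by rewrite mulr_ge0// ltW.
have Hmu : `|\int[mu]_x phi (h x) -
    \sum_(i < K) c i * fine (mu [set x | W x (A i)])| <= 2 * dl.
  rewrite [leRHS](_ : _ = 2 * dl * fine (mu setT)); last by rewrite mu1 mulr1.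
  apply: (@partition_integral _ _ _ mu mu_fin (phi \o h) M (fun i => [set x | W x (A i)])).
  - exact: measurableT_comp measurable_h.
  - by move=> x; exact: phiM.
  - by move=> i; exact: mW.
  - move=> i j x Wi Wj; have [y [Ai Aj]] := filter_ex (filterI Wi Wj).
    exact: dA Ai Aj.
  - exact: dl2.
  - apply: filterS bounded_part_ae => x bx; have [i iK Wi] := W_cover x cover.
    by exists i; split=> //; exact: phi_h.
have Hnu n : `|\int[nu n]_x phi (g x) -
    \sum_(i < K) c i * fine (nu n (@g n @^-1` A i))| <= 2 * dl.
  rewrite [leRHS](_ : _ = 2 * dl * fine (nu n setT)); last by rewrite probability_setT mulr1.
  have nu_fin : (nu n setT < +oo)%E by rewrite probability_setT ltry.
  apply: (@partition_integral _ _ _ (nu n) nu_fin (phi \o @g n) M (fun i => @g n @^-1` A i)).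
  - exact: measurableT_comp.
  - by move=> x; exact: phiM.
  - by move=> i; rewrite -[X in measurable X]setTI; exact: mg.
  - move=> i j x; exact: dA.
  - exact: dl2.
  - apply: nearW => x; have [i iK Ai] := cover (g x); exists i; split=> //.
    by move/AE: Ai => /andP[a1 a2]; rewrite /= ler_norml; lra.
have sum_cvg : (\sum_(i < K) c i * fine (nu n (@g n @^-1` A i))) @[n --> F] -->
    \sum_(i < K) c i * fine (mu [set x | W x (A i)]).
  apply: cvg_big => [|i _]; first exact: add_continuous.
  by apply: cvgMl_tmp; exact: muW.
move/cvgrPdist_le : sum_cvg => /(_ _ dl0); apply: filterS => n Hn.
move: Hmu (Hnu n) Hn.
move: (Rintegral _ _ _) (Rintegral _ _ _) (\sum_(i < K) _) (\sum_(i < K) _) => a b' c' d'.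
rewrite !ler_norml /dl => /andP[? ?] /andP[? ?] /andP[? ?]; lra.
Qed.

Let tail_le_integrable n (m : nat) (e : R) :
  (\int[nu n]_(x in [set x | (m%:R <= `|g x|)%R]) `|g x|%:E <= e%:E)%E ->
  (nu n).-integrable setT (EFin \o @g n).
Proof.
move=> H; apply: (tail_integrable (probability_setT (nu n)) (@mg n) (ler0n _ m)).
by rewrite (le_lt_trans H)// ltry.
Qed.

Let integrable_h : mu.-integrable setT (EFin \o h).
Proof.
apply/integrableP; split; first exact/measurable_EFinP.
have [m Hm] := tails ltr01.
(* On the side of nu_n the truncated integral is at most m plus a tail of at most 1; the last 1 is
   the error of the approximation along F. The bound is the same for all k, as monotone convergence
   requires. *)
pose C : R := m%:R + 1 + 1.
pose phi (k : nat) (y : R) : R := Num.min k%:R `|y|.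
have phi0 k y : 0 <= phi k y by rewrite le_min ler0n normr_ge0.
have mphi k : measurable_fun setT (phi k).
  by apply: measurable_minr => //.
have bphi k y : `|phi k y| <= k%:R by rewrite ger0_norm// ge_min lexx.
have intC k : (\int[mu]_x (phi k (h x))%:E <= C%:E)%E.
  have ic : mu.-integrable setT (EFin \o (phi k \o h)).
    apply: (bounded_integrable mu_fin (M := k%:R)); last by move=> x; exact: bphi.
    exact: measurableT_comp measurable_h.
  have /cvgrPdist_le/(_ _ ltr01) H := lip_limit (mphi k) (bphi k) (minnorm_lip k%:R).
  have [n [H1 H2]] := filter_ex (filterI H (Hm m (leqnn m))).
  rewrite -(fineK (integrable_fin_num measurableT ic)) lee_fin /C.
  have H3 : \int[nu n]_x phi k (g x) <= m%:R + 1.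
    have nu_fin : (nu n setT < +oo)%E by rewrite probability_setT ltry.
    have icn : (nu n).-integrable setT (EFin \o (phi k \o @g n)).
      apply: (bounded_integrable nu_fin (M := k%:R)); last by move=> x; exact: bphi.
      exact: measurableT_comp.
    rewrite -lee_fin (fineK (integrable_fin_num measurableT icn)).
    apply: (@le_trans _ _ (m%:R%:E + \int[nu n]_(x in [set x | (m%:R <= `|g x|)%R]) `|g x|%:E)%E);
      last by rewrite EFinD leeD2l.
    apply: le_trans (integral_norm_le_tail (probability_setT (nu n)) (@mg n) (ler0n _ m)).
    apply: ge0_le_integral => //.
    - by move=> x _; rewrite lee_fin; exact: phi0.
    - apply/measurable_EFinP; exact: measurableT_comp.
    - apply/measurable_EFinP; exact: measurableT_comp.
    - by move=> x _; rewrite lee_fin ge_min lexx orbT.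
  move: H1 => /= /(le_trans (ler_norm _)); rewrite lerBlDr => /le_trans; apply.
  by rewrite addrC lerD2r.
have phi_lim x : limn (fun k => (phi k (h x))%:E) = `|(EFin \o h) x|%E.
  apply: lim_near_cst => //; exists (Num.truncn `|h x|).+1 => // k /= hk.
  rewrite /phi min_r//; apply: (@le_trans _ _ (Num.truncn `|h x|).+1%:R); last by rewrite ler_nat.
  by have /andP[_ /ltW] := truncn_itv (normr_ge0 (h x)).
under eq_integral do rewrite -phi_lim.
apply: (@le_lt_trans _ _ C%:E); last exact: ltry.
have mphih k : measurable_fun setT (fun x => (phi k (h x))%:E).
  by apply/measurable_EFinP; exact: measurableT_comp measurable_h.
have ndphi x : nondecreasing_seq (fun k => (phi k (h x))%:E).
  move=> i j ij; rewrite lee_fin /phi le_min ge_min ge_min lexx orbT andbT.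
  by rewrite ler_nat ij.
rewrite monotone_convergence//; last first.
  by move=> k x _; rewrite lee_fin; exact: phi0.
apply: lime_le; last by apply: nearW => k; exact: intC.
apply: ereal_nondecreasing_is_cvgn => i j ij; apply: ge0_le_integral => //.
- by move=> x _; rewrite lee_fin; exact: phi0.
- by move=> x _; exact: ndphi.
Qed.

Theorem limit_integral : [/\ \forall x \ae mu, bounded_part x,
  mu.-integrable setT (EFin \o h) &
  (\int[nu n]_x g x) @[n --> F] --> \int[mu]_x h x].
Proof.
split; [exact: bounded_part_ae|exact: integrable_h|].
have clip_cvg : (\int[mu]_x (clip k%:R (h x))) @[k --> \oo] --> \int[mu]_x h x.
  have mclip k : measurable_fun setT (EFin \o (clip k%:R \o h)).
    by apply/measurable_EFinP; apply: measurableT_comp measurable_h; exact: measurable_clip.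
  have [|||_ _] := @dominated_convergence _ _ _ mu _ measurableT _ (EFin \o h) _ mclip _ _
    (integrable_abse integrable_h) _.
  - exact/measurable_EFinP.
  - apply: nearW => x _; apply: cvg_near_cst; exists (Num.truncn `|h x|).+1 => // k /= hk.
    rewrite clip_id//; apply: (@lt_le_trans _ _ (Num.truncn `|h x|).+1%:R); last by rewrite ler_nat.
    by have /andP[] := truncn_itv (normr_ge0 (h x)).
  - by apply: nearW => x k _ /=; rewrite lee_fin clip_norm.
  have ih := integrable_fin_num measurableT integrable_h.
  by rewrite -(fineK ih) => /fine_cvg.
(* The three errors are the truncation of h, the limit at a fixed truncation, and the truncation of
   g n. The level m is fixed before n, so no convergence uniform in m is asked for. *)
apply/cvgrPdist_le => /= e e0; have e3 : 0 < e / 3 by rewrite divr_gt0.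
have [m0 Hm0] := tails e3.
move/cvgrPdist_le : clip_cvg => /(_ _ e3)[k0 _ Hk0].
pose m := maxn m0 k0; have {Hk0}Hk := Hk0 m (leq_maxr _ _).
have {Hm0}Hm := Hm0 m (leq_maxl _ _).
have /cvgrPdist_le/(_ _ e3) Hc := lip_limit (measurable_clip m%:R)
  (fun y => clip_bounded y (ler0n _ m)) (clip_lip m%:R).
apply: filterS (filterI Hm Hc) => n [/= Hn1 Hn2].
have Hn3 := clip_integral_error (probability_setT (nu n)) (@mg n) (ler0n _ m) (tail_le_integrable Hn1) Hn1.
move: Hk Hn2 Hn3 => /=.
move: (Rintegral _ _ _) (Rintegral _ _ _) (Rintegral _ _ _) (Rintegral _ _ _) => a b' c' d'.
rewrite !ler_norml => /andP[? ?] /andP[? ?] /andP[? ?]; lra.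
Qed.

End limit_integral.

(** * The Loeb space of the internal space *)

Lemma dist_add_le (R : realType) (r s p q e : R) :
  `|r - p| <= e / 2 -> `|s - q| <= e / 2 -> `|r + s - (p + q)| <= e.
Proof.
move=> rp sq; rewrite opprD addrACA (le_trans (ler_normD _ _))//.
by rewrite (splitr e) lerD.
Qed.

Section internal_space.
Context (R : realType) (d : measure_display) (E : measurableType d) (X Y : Type).
Context (b : base_embedding R E X) (star : superstructure X -> superstructure Y).
Hypothesis hstar : nonstandard_extension star.
Context (k : nat) (np : nat -> nat) (knp : forall n, (k < np n)%N).
Context (Omega : forall n, set ((np n).-tuple E)) (Omega0 : forall n, Omega n !=set0).
Context (nu : forall n, probability (induced_space (Omega0 n)) R).
Context (f : k.-tuple E -> R).
Hypothesis mf : measurable_fun [set: k.-tuple E] f.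
Context (N : superstructure Y).
Hypothesis N_inf : infinite_hypernat b star N.

Local Notation S n := (induced_space (Omega0 n)).
Local Notation g := (pull knp Omega0 f).

Definition vnat (n : nat) : superstructure X := vreal b n%:R.

Lemma vnat_inj : injective vnat.
Proof. by move=> m n /vreal_inj/eqP; rewrite eqr_nat => /eqP. Qed.

Lemma ranked_vnat : ranked (range vnat).
Proof. exact: ranked_atoms. Qed.

Local Notation U := (ultra star vnat N).

Let NT : U setT. Proof. by case: N_inf. Qed.

#[local] Instance ultra_N : ProperFilter U.
Proof. exact: (ultra_filter hstar vnat_inj ranked_vnat NT). Qed.

Let losN := los hstar vnat_inj ranked_vnat NT.

(** As N differs from every standard number, the ultrafilter contains no singleton, and therefore it
    contains every cofinite set. *)
Lemma ultra_N_infinite (A : set nat) : (\forall n \near \oo, A n) -> U A.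
Proof.
have U1 i : U (~` [set i]).
  have [Ui|//] := ultraC hstar vnat_inj ranked_vnat NT [set i].
  case: N_inf => _ /(_ i); case.
  have := los_base hstar vnat_inj ranked_vnat NT (P := fun Z e => e 0%N = e 1%N) (fun=> vnat i).
  case; first exact: definable_eq.
  by move=> _; apply; apply: filterS Ui => j /= ->.
move=> [m _ mA]; apply: (filterS mA); elim: m {mA} => [|m IH]; first exact: filterE.
by apply: filterS (filterI IH (U1 m)) => n [/= mn /eqP nm]; rewrite ltn_neqAle eq_sym nm.
Qed.

Let Uk : U [set n | (k < n)%N].
Proof. by apply: ultra_N_infinite; exists k.+1. Qed.

Let reps := represents star vnat N.

Let rep_seq u : ranked (range u) -> reps (vapp (star (vseq b k u)) N, u).
Proof. by move=> ru; right; exists [set n | (k < n)%N], u. Qed.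

Let rep_const c : reps (star c, fun=> c).
Proof. by left; right; exists c. Qed.

Let vsubset_range n (A : set (S n)) : range (@decode X 1) (vsubset b A).
Proof. by apply: mkset_range => _ [x _ <-]; exists (base_tuple b (subset_val (Omega0 n) x)). Qed.

Let ranked_vsubset (I : Type) (n : I -> nat) (A : forall i, set (S (n i))) :
  ranked (range (fun i => vsubset b (A i))).
Proof. by exists 1%N => _ [i _ <-]; exact: vsubset_range. Qed.

Let ranked_vsubsets (P : forall n, set (set (S n))) :
  ranked (range (fun n => mkset (@vsubset _ _ _ _ b _ _ Omega0 n @` P n))).
Proof.
by exists 2%N => _ [n _ <-]; apply: mkset_range => _ [A _ <-]; exact: vsubset_range.
Qed.

Let mem_vsubset n (A : set (S n)) y :
  vmem y (vsubset b A) <-> exists2 x, A x & vtuple b (subset_val (Omega0 n) x) = y.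
Proof.
by rewrite /vsubset mem_mkset; [split=> -[x]; exists x|exact: ranked_atoms].
Qed.

Lemma vtuple_inj n : injective (@vtuple R d E X b n).
Proof. by move=> x y xy; apply: (@base_tuple_inj _ _ _ b); exact: atom_inj xy. Qed.

Lemma subset_val_inj n : injective (subset_val (Omega0 n)).
Proof. by move=> x y; exact: eq_sig_hprop. Qed.

Let mem_vsubset_val n (A : set (S n)) x :
  vmem (vtuple b (subset_val (Omega0 n) x)) (vsubset b A) <-> A x.
Proof.
rewrite mem_vsubset; split=> [[y Ay /vtuple_inj/subset_val_inj <-]//|Ax].
by exists x.
Qed.

Let vsubset_inj n : injective (@vsubset _ _ _ _ b _ _ Omega0 n).
Proof.
by move=> A B AB; apply/seteqP; split=> x; rewrite -!mem_vsubset_val AB.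
Qed.

Let mem_vsubsets n (P : set (set (S n))) y :
  vmem y (mkset (@vsubset _ _ _ _ b _ _ Omega0 n @` P)) <->
  exists2 A, P A & vsubset b A = y.
Proof.
rewrite mem_mkset; first by split=> -[A]; exists A.
by apply: (ranked_sub _ (ranked_vsubset (n := fun=> n) (fun A => A))) => _ [A _ <-]; exists A.
Qed.

(** * The N-th terms and the sequences representing them *)

Let seqOmega n := vsubset b [set: S n].
Let seqF n := mkset (@vsubset _ _ _ _ b _ _ Omega0 n @` measurable).
Let seqnu n := vfun measurable (@vsubset _ _ _ _ b _ _ Omega0 n)
  (fun A => vreal b (fine (nu n A))).
Let seqproj n := vfun [set: (np n).-tuple E] (@vtuple R d E X b (np n))
  (fun x => vtuple b (tuple_proj (ltnW (knp n)) x)).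
(** The N-th terms of [seqL A] and [seqV A] are {x | *f x in *A} and {B | nu_N B in *A}; they
    express these two conditions in formulas as plain memberships. *)
Let seqL (A : set R) n := vsubset b (g n @^-1` A).
Let seqV (A : set R) n := mkset (@vsubset _ _ _ _ b _ _ Omega0 n @`
  [set B | measurable B /\ A (fine (nu n B))]).

Let OmegaN := vapp (star (vOmega_seq b k Omega0)) N.
Let FN := vapp (star (vF_seq b k Omega0)) N.
Let nuN := vapp (star (vnu_seq b k nu)) N.
Let projN := vapp (star (vproj_seq b knp)) N.
Let LN A := vapp (star (vseq b k (seqL A))) N.
Let VN A := vapp (star (vseq b k (seqV A))) N.

Let repOmega : reps (OmegaN, seqOmega).
Proof. exact: (rep_seq (ranked_vsubset (n := id) (fun n => [set: S n]))). Qed.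

Let repF : reps (FN, seqF).
Proof. exact: (rep_seq (ranked_vsubsets (fun n => measurable))). Qed.

Let repnu : reps (nuN, seqnu).
Proof.
apply: rep_seq; exists 4%N => _ [n _ <-]; apply: vfun_range.
  by move=> _ [A _ <-]; exact: vsubset_range.
by move=> _ [A _ <-]; apply: range_decodeS; exists (base_real b (fine (nu n A))).
Qed.

Let repproj : reps (projN, seqproj).
Proof.
apply: rep_seq; exists 3%N => _ [n _ <-]; apply: vfun_range.
  by move=> _ [x _ <-]; exists (base_tuple b x).
by move=> _ [x _ <-]; exists (base_tuple b (tuple_proj (ltnW (knp n)) x)).
Qed.

Let repL A : reps (LN A, seqL A).
Proof. exact: (rep_seq (ranked_vsubset (n := id) (fun n => g n @^-1` A))). Qed.

Let repV A : reps (VN A, seqV A).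
Proof. exact: (rep_seq (ranked_vsubsets _)). Qed.

Let losP (P : vpred) l : definable P ->
  foldr (fun a Q => reps a /\ Q) True l ->
  P Y (fun i => (nth (N, vnat) l i).1) <->
  U [set n | P X (fun i => (nth (N, vnat) l i).2 n)].
Proof.
move=> dP lreps; apply: losN => //.
by elim: l lreps => [|a l IH]//= [ra rl] [|i]//; exact: IH.
Qed.

Let los_all_n (P : vpred) l : definable P ->
  foldr (fun a Q => reps a /\ Q) True l ->
  (forall n, P X (fun i => (nth (N, vnat) l i).2 n)) ->
  P Y (fun i => (nth (N, vnat) l i).1).
Proof. by move=> dP lreps PX; apply/losP => //; exact: filterE. Qed.

(* The representing sequence is chosen by the syntax of the hyperfinite object:
   trying the lemmas in turn would unfold the sequences to compare them. *)
Ltac reps_tac :=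
  hnf; lazymatch goal with
  | |- True => exact: I
  | |- _ /\ _ => split; [lazymatch goal with
      | |- reps (OmegaN, _) => exact: repOmega
      | |- reps (FN, _) => exact: repF
      | |- reps (nuN, _) => exact: repnu
      | |- reps (projN, _) => exact: repproj
      | |- reps (LN _, _) => exact: repL
      | |- reps (VN _, _) => exact: repV
      | |- reps (star _, _) => exact: rep_const
      end | reps_tac]
  end.

(** * The internal algebra, measure and function by transfer *)

Lemma OmegaN_nonempty : members OmegaN !=set0.
Proof.
suff [x xO _] : exists2 x, vmem x OmegaN & x = x by exists x.
apply: (@los_all_n (fun Z e => exists2 x, vmem x (e 0%N) & x = x)
  [:: (OmegaN, seqOmega)]); [definable_tac|reps_tac|move=> n /=].
by exists (vtuple b (subset_val (Omega0 n) point)) => //; apply/mem_vsubset_val.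
Qed.

Lemma FN_sub B x : vmem B FN -> vmem x B -> vmem x OmegaN.
Proof.
move=> BF; move: B BF x.
apply: (@los_all_n (fun Z e => forall B, vmem B (e 1%N) -> forall x, vmem x B ->
  vmem x (e 0%N)) [:: (OmegaN, seqOmega); (FN, seqF)]); [definable_tac|reps_tac|].
move=> n /= _ /mem_vsubsets[A mA <-] _ /mem_vsubset[x _ <-].
by apply/mem_vsubset_val.
Qed.

Lemma FN_setC B : vmem B FN -> exists2 C, vmem C FN &
  forall x, vmem x OmegaN -> (vmem x C <-> ~ vmem x B).
Proof.
move: B; apply: (@los_all_n (fun Z e => forall B, vmem B (e 1%N) -> exists2 C, vmem C (e 1%N) &
  forall x, vmem x (e 0%N) -> (vmem x C <-> ~ vmem x B))
  [:: (OmegaN, seqOmega); (FN, seqF)]); [definable_tac|reps_tac|].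
move=> n /= _ /mem_vsubsets[A mA <-]; exists (vsubset b (~` A)).
  by apply/mem_vsubsets; exists (~` A) => //; exact: measurableC.
by move=> _ /mem_vsubset[x _ <-]; rewrite !mem_vsubset_val.
Qed.

Lemma FN_setU B C : vmem B FN -> vmem C FN -> exists2 D, vmem D FN &
  forall x, vmem x OmegaN -> (vmem x D <-> vmem x B \/ vmem x C).
Proof.
move=> BF; move: B BF C.
apply: (@los_all_n (fun Z e => forall B, vmem B (e 1%N) -> forall C, vmem C (e 1%N) ->
  exists2 D, vmem D (e 1%N) &
  forall x, vmem x (e 0%N) -> (vmem x D <-> vmem x B \/ vmem x C))
  [:: (OmegaN, seqOmega); (FN, seqF)]); [definable_tac|reps_tac|].
move=> n /= _ /mem_vsubsets[A mA <-] _ /mem_vsubsets[A' mA' <-].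
exists (vsubset b (A `|` A')).
  by apply/mem_vsubsets; exists (A `|` A') => //; exact: measurableU.
by move=> _ /mem_vsubset[x _ <-]; rewrite !mem_vsubset_val.
Qed.

Lemma FN_set0 : exists2 B, vmem B FN & forall x, vmem x OmegaN -> ~ vmem x B.
Proof.
apply: (@los_all_n (fun Z e => exists2 B, vmem B (e 1%N) &
  forall x, vmem x (e 0%N) -> ~ vmem x B)
  [:: (OmegaN, seqOmega); (FN, seqF)]); [definable_tac|reps_tac|].
move=> n /=; exists (vsubset b (@set0 (S n))).
  by apply/mem_vsubsets; exists set0.
by move=> _ /mem_vsubset[x _ <-]; rewrite !mem_vsubset_val.
Qed.

(** Saturation requires members of the extension of a standard set; here that set collects the
    subsets of Omega_n for all n. *)
Lemma FN_internal B : vmem B FN -> internal star B.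
Proof.
pose c := mkset (\bigcup_n (@vsubset _ _ _ _ b _ _ Omega0 n @` setT)).
move=> BF; exists c; move: B BF.
apply: (@los_all_n (fun Z e => forall B, vmem B (e 0%N) -> vmem B (e 1%N))
  [:: (FN, seqF); (star c, fun=> c)]); [definable_tac|reps_tac|].
move=> n /= _ /mem_vsubsets[A mA <-]; apply/mem_mkset; last by exists n => //; exists A.
by exists 1%N => _ [m _ [B _ <-]]; exact: vsubset_range.
Qed.

Lemma mem_VN n (A : set R) (B : set (S n)) :
  vmem (vsubset b B) (seqV A n) <-> measurable B /\ A (fine (nu n B)).
Proof.
rewrite mem_vsubsets; split=> [[B' HB' /vsubset_inj <-//]|HB].
by exists B.
Qed.

(** Additivity of nu_N in a form free of internal sums: the arithmetic is a condition on the
    standard sets A1, A2 and A3, checked at each n. *)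
Lemma VN_setU (A1 A2 A3 : set R) B C D : (forall r s, A1 r -> A2 s -> A3 (r + s)) ->
  vmem B FN -> vmem C FN -> vmem D FN -> vmem B (VN A1) -> vmem C (VN A2) ->
  (forall x, vmem x OmegaN -> ~ (vmem x B /\ vmem x C)) ->
  (forall x, vmem x OmegaN -> (vmem x D <-> vmem x B \/ vmem x C)) ->
  vmem D (VN A3).
Proof.
move=> A123 BF CF DF; move: B BF C CF D DF.
apply: (@los_all_n (fun Z e => forall B, vmem B (e 1%N) -> forall C, vmem C (e 1%N) ->
  forall D, vmem D (e 1%N) -> vmem B (e 2%N) -> vmem C (e 3%N) ->
  (forall x, vmem x (e 0%N) -> ~ (vmem x B /\ vmem x C)) ->
  (forall x, vmem x (e 0%N) -> (vmem x D <-> vmem x B \/ vmem x C)) -> vmem D (e 4%N))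
  [:: (OmegaN, seqOmega); (FN, seqF); (VN A1, seqV A1); (VN A2, seqV A2);
      (VN A3, seqV A3)]); [definable_tac|reps_tac|].
move=> n /= _ /mem_vsubsets[B mB <-] _ /mem_vsubsets[C mC <-] _ /mem_vsubsets[D mD <-].
rewrite !mem_VN => -[_ B1] [_ C2] BC0 DBC; split=> //.
have BC : B `&` C = set0.
  apply/seteqP; split=> // x [Bx Cx].
  apply: (BC0 (vtuple b (subset_val (Omega0 n) x))); first exact/mem_vsubset_val.
  by split; apply/mem_vsubset_val.
have -> : D = B `|` C.
  apply/seteqP; split=> x; have := DBC (vtuple b (subset_val (Omega0 n) x));
    by rewrite !mem_vsubset_val => /(_ Logic.I)[].
by rewrite measureU// fineD ?fin_num_measure//; exact: A123.
Qed.

(** One formula provides the value of nu_N at B, its uniqueness in the shape asked by [vapp_eq], and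
    its relation to [VN A]. *)
Lemma nuN_hyper B (A : set R) : vmem B FN ->
  ultra star (vreal b) (vapp nuN B) A <-> vmem B (VN A).
Proof.
move=> BF; suff [y yR [By [yu yA]]] : exists2 y, vmem y (star (mkset (range (vreal b)))) &
    vmem (vpair B y) nuN /\ (forall q, vmem q nuN -> forall a, vmem a q ->
      forall z, vmem z a -> q = vpair B z -> z = y) /\
    (vmem B (VN A) <-> vmem y (star (mkset (vreal b @` A)))).
  by rewrite (vapp_eq By yu) yA.
move: B BF.
apply: (@los_all_n (fun Z e => forall B, vmem B (e 0%N) -> exists2 y, vmem y (e 3%N) &
    vmem (vpair B y) (e 1%N) /\ (forall q, vmem q (e 1%N) -> forall a, vmem a q ->
      forall z, vmem z a -> q = vpair B z -> z = y) /\
    (vmem B (e 2%N) <-> vmem y (e 4%N)))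
  [:: (FN, seqF); (nuN, seqnu); (VN A, seqV A);
      (star (mkset (range (vreal b))), fun=> mkset (range (vreal b)));
      (star (mkset (vreal b @` A)), fun=> mkset (vreal b @` A))]);
  [definable_tac|reps_tac|].
move=> n /= _ /mem_vsubsets[B mB <-]; exists (vreal b (fine (nu n B))).
  by apply/(mem_mkset _ (ranked_vreal b)); exists (fine (nu n B)).
have nuP z : vmem (vpair (vsubset b B) z) (seqnu n) <-> z = vreal b (fine (nu n B)).
  rewrite mem_vfun_pair; [|exact: (ranked_vsubset (n := fun=> n) id)|exact: ranked_atoms].
  by split=> [[B' _ [/vsubset_inj -> ->]]//|->]; exists B.
split; first exact/nuP.
split; first by move=> q qn _ _ z _ qE; apply/nuP; rewrite -qE.
by rewrite mem_VN (mem_mkset_image (@vreal_inj _ _ _ _ b) (ranked_vreal b)); split=> [[]|].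
Qed.

Let fN x := vapp (star (vf b f)) (vapp projN x).

(** Two applications are nested, the projection and then *f, so the transferred formula yields two
    witnesses, each with its uniqueness clause. *)
Lemma fN_hyper x (A : set R) : vmem x OmegaN ->
  ultra star (vreal b) (fN x) A <-> vmem x (LN A).
Proof.
pose tups := mkset (range (@vtuple R d E X b k)).
move=> xO; suff [y yT [xy [yu [z zR [yz [zu zA]]]]]] : exists2 y, vmem y (star tups) &
    vmem (vpair x y) projN /\
    (forall q, vmem q projN -> forall a, vmem a q ->
      forall y', vmem y' a -> q = vpair x y' -> y' = y) /\
    exists2 z, vmem z (star (mkset (range (vreal b)))) &
    vmem (vpair y z) (star (vf b f)) /\
    (forall q, vmem q (star (vf b f)) -> forall a, vmem a q ->
      forall z', vmem z' a -> q = vpair y z' -> z' = z) /\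
    (vmem x (LN A) <-> vmem z (star (mkset (vreal b @` A)))).
  by rewrite /fN (vapp_eq xy yu) (vapp_eq yz zu) zA.
move: x xO.
apply: (@los_all_n (fun Z e => forall x, vmem x (e 0%N) -> exists2 y, vmem y (e 6%N) &
    vmem (vpair x y) (e 1%N) /\
    (forall q, vmem q (e 1%N) -> forall a, vmem a q ->
      forall y', vmem y' a -> q = vpair x y' -> y' = y) /\
    exists2 z, vmem z (e 4%N) &
    vmem (vpair y z) (e 2%N) /\
    (forall q, vmem q (e 2%N) -> forall a, vmem a q ->
      forall z', vmem z' a -> q = vpair y z' -> z' = z) /\
    (vmem x (e 3%N) <-> vmem z (e 5%N)))
  [:: (OmegaN, seqOmega); (projN, seqproj); (star (vf b f), fun=> vf b f); (LN A, seqL A);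
      (star (mkset (range (vreal b))), fun=> mkset (range (vreal b)));
      (star (mkset (vreal b @` A)), fun=> mkset (vreal b @` A));
      (star tups, fun=> tups)]); [definable_tac|reps_tac|].
move=> n /= _ /mem_vsubset[x _ <-].
set y := tuple_proj (ltnW (knp n)) (subset_val (Omega0 n) x).
have projP y' : vmem (vpair (vtuple b (subset_val (Omega0 n) x)) y') (seqproj n) <->
    y' = vtuple b y.
  rewrite mem_vfun_pair; [|exact: ranked_atoms|exact: ranked_atoms].
  by split=> [[x' _ [/vtuple_inj <- ->]]//|->]; exists (subset_val (Omega0 n) x).
have fP z : vmem (vpair (vtuple b y) z) (vf b f) <-> z = vreal b (f y).
  rewrite mem_vfun_pair; [|exact: ranked_atoms|exact: ranked_atoms].
  by split=> [[y' _ [/vtuple_inj <- ->]]//|->]; exists y.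
exists (vtuple b y); first by apply/mem_mkset; [exact: ranked_atoms|exists y].
split; first exact/projP.
split; first by move=> q qn _ _ y' _ qE; apply/projP; rewrite -qE.
exists (vreal b (f y)); first by apply/(mem_mkset _ (ranked_vreal b)); exists (f y).
split; first exact/fP.
split; first by move=> q qn _ _ z _ qE; apply/fP; rewrite -qE.
by rewrite mem_vsubset_val (mem_mkset_image (@vreal_inj _ _ _ _ b) (ranked_vreal b)).
Qed.

Lemma measurable_pull n : measurable_fun setT (g n).
Proof.
have mp : measurable_fun setT
    (tuple_proj (ltnW (knp n)) : (np n).-tuple E -> k.-tuple E).
  apply/measurable_fun_tnthP => i.
  rewrite (_ : _ \o _ = (@tnth _ E)^~ (widen_ord (ltnW (knp n)) i)); last first.
    by apply/funext => x /=; rewrite tnth_mktuple.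
  exact: measurable_tnth.
have ms : measurable_fun setT (subset_val (Omega0 n) : S n -> (np n).-tuple E).
  by move=> _ B mB; rewrite setTI; exists B => //; rewrite setTI.
exact: measurableT_comp mf (measurableT_comp mp ms).
Qed.

Let measurable_preimage n A : measurable A -> measurable (g n @^-1` A).
Proof. by move=> mA; rewrite -[X in measurable X]setTI; exact: measurable_pull. Qed.

Lemma LN_FN A : measurable A -> vmem (LN A) FN.
Proof.
move=> mA.
apply: (@los_all_n (fun Z e => vmem (e 1%N) (e 0%N))
  [:: (FN, seqF); (LN A, seqL A)]); [definable_tac|reps_tac|].
move=> n /=; apply/mem_vsubsets; exists (g n @^-1` A) => //.
exact: measurable_preimage.
Qed.

(** With B an interval around the standard part of nu_N at [LN A], this says that this standard part
    is the limit along U of nu_n(f in A). *)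
Lemma nuN_LN (A B : set R) : measurable A ->
  ultra star (vreal b) (vapp nuN (LN A)) B <->
  U [set n | B (fine (nu n (g n @^-1` A)))].
Proof.
move=> mA; rewrite (nuN_hyper _ (LN_FN mA)).
rewrite (@losP (fun Z e => vmem (e 1%N) (e 0%N))
  [:: (VN B, seqV B); (LN A, seqL A)]); [|definable_tac|reps_tac].
split; apply: filterS => n /=; rewrite mem_VN; first by case.
by move=> Bn; split=> //; exact: measurable_preimage.
Qed.

Lemma nuN_01 B : vmem B FN -> ultra star (vreal b) (vapp nuN B) [set y : R | 0 <= y <= 1].
Proof.
move=> BF; apply/(nuN_hyper _ BF); move: B BF.
apply: (@los_all_n (fun Z e => forall B, vmem B (e 0%N) -> vmem B (e 1%N))
  [:: (FN, seqF); (VN [set y : R | 0 <= y <= 1], seqV [set y : R | 0 <= y <= 1])]);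
  [definable_tac|reps_tac|].
move=> n /= _ /mem_vsubsets[B mB <-]; apply/mem_VN; split=> //=.
by rewrite fine_ge0//= -lee_fin fineK ?fin_num_measure// probability_le1.
Qed.

Let alphaN := vapp (star (valpha_seq b knp nu f)) N.

Lemma alphaN_hyper (A : set R) :
  (\forall n \near \oo, (nu n).-integrable setT (EFin \o g n)) ->
  ultra star (vreal b) alphaN A <-> U [set n | A (\int[nu n]_x g n x)].
Proof.
(* The sequence of integrals is partial; its domain D belongs to U because f is integrable for all
   large n. *)
move=> ig; set D := [set n | (k < n)%N /\ (nu n).-integrable setT (EFin \o g n)].
have UD : U D by apply: filterI => //; exact: ultra_N_infinite.
have repa : reps (alphaN, fun n => vreal b (\int[nu n]_x g n x)).
  by right; exists D, (fun n => vreal b (\int[nu n]_x g n x)); split=> //; exact: ranked_atoms.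
rewrite /ultra/=.
rewrite (@losP (fun Z e => vmem (e 0%N) (e 1%N))
  [:: (alphaN, fun n => vreal b (\int[nu n]_x g n x));
      (star (mkset (vreal b @` A)), fun=> mkset (vreal b @` A))]);
  [|definable_tac|by split=> //; split=> //; exact: rep_const].
by split; apply: filterS => n /=; rewrite (mem_mkset_image (@vreal_inj _ _ _ _ b) (ranked_vreal b)).
Qed.

(** * Standard parts of the values of nu_N *)

Local Notation stN B := (st b star (vapp nuN B)).

Lemma nuN_finite B : vmem B FN -> finite_hyperreal b star (vapp nuN B).
Proof.
move=> BF; have nT : ultra star (vreal b) (vapp nuN B) setT.
  apply/(nuN_hyper _ BF); move: B BF.
  apply: (@los_all_n (fun Z e => forall B, vmem B (e 0%N) -> vmem B (e 1%N))
    [:: (FN, seqF); (VN setT, seqV setT)]); [definable_tac|reps_tac|].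
  by move=> n /= _ /mem_vsubsets[B mB <-]; apply/mem_VN.
split=> //; exists 1%N; apply/hle_hnorm => //.
have UF := ultra_filter hstar (@vreal_inj _ _ _ _ b) (ranked_vreal b) nT.
by apply: filterS (nuN_01 BF) => y /= /andP[y0 y1]; rewrite ger0_norm.
Qed.

Lemma stN_near B (e : R) : vmem B FN -> 0 < e ->
  vmem B (VN [set y : R | `|y - stN B| <= e]).
Proof. by move=> BF e0; apply/(nuN_hyper _ BF); exact: finite_near_st (nuN_finite BF) _ _. Qed.

Lemma stN_ge0 B : vmem B FN -> 0 <= stN B.
Proof.
move=> BF; have nT : ultra star (vreal b) (vapp nuN B) setT by have [] := nuN_finite BF.
have UF := ultra_filter hstar (@vreal_inj _ _ _ _ b) (ranked_vreal b) nT.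
apply/ler_addgt0Pl => e e0; rewrite addrC -lerBlDr sub0r.
have [y [/= /andP[y0 _]]] := filter_ex (filterI (nuN_01 BF) (finite_near_st hstar (nuN_finite BF) e0)).
rewrite ler_distl => /andP[_ ye]; rewrite -subr_ge0 opprK.
by rewrite (le_trans y0).
Qed.

(** By [VN_setU] with intervals of radius e / 2, the measure of D is within e of the sum of the two
    standard parts for every e > 0; a hyperreal is that close to only one real. *)
Lemma stN_setU B C D : vmem B FN -> vmem C FN -> vmem D FN ->
  (forall x, vmem x OmegaN -> ~ (vmem x B /\ vmem x C)) ->
  (forall x, vmem x OmegaN -> (vmem x D <-> vmem x B \/ vmem x C)) ->
  stN D = stN B + stN C.
Proof.
move=> BF CF DF BC0 DBC.
have nT : ultra star (vreal b) (vapp nuN D) setT by have [] := nuN_finite DF.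
have UF := ultra_filter hstar (@vreal_inj _ _ _ _ b) (ranked_vreal b) nT.
apply: (hyper_near_unique hstar nT (finite_near_st hstar (nuN_finite DF))) => e e0.
have e2 : 0 < e / 2 by rewrite divr_gt0.
apply/(nuN_hyper _ DF).
apply: (VN_setU _ BF CF DF (stN_near BF e2) (stN_near CF e2) BC0 DBC) => r s.
exact: dist_add_le.
Qed.

(** * The algebra of traces and its Loeb measure *)

Context (OmegaN0 : members OmegaN !=set0).
Local Notation tr := (@trace_set Y OmegaN OmegaN0).
Local Notation G := (@internal_algebra Y OmegaN FN OmegaN0).
Local Notation val := (@subset_val _ _ OmegaN0).

Let tr_ext B C : tr B = tr C -> forall x, vmem x OmegaN -> (vmem x B <-> vmem x C).
Proof.
move=> BC x xO; have := congr1 (fun A => A (exist _ x xO : subset_type OmegaN0)) BC.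
by rewrite /trace_set/= => ->.
Qed.

(** An internal set Z without points has standard measure 0 by additivity, and C has the points of B
    or Z, so additivity compares C with B. This makes the measure well defined on traces. *)
Lemma stN_ext B C : vmem B FN -> vmem C FN ->
  (forall x, vmem x OmegaN -> (vmem x B <-> vmem x C)) -> stN B = stN C.
Proof.
move=> BF CF BC; have [Z ZF Z0] := FN_set0.
have Z1 : stN Z = 0.
  apply: (@addrI _ (stN Z)); rewrite addr0 -(stN_setU ZF ZF ZF)//.
    by move=> x xO [/(Z0 _ xO)].
  by move=> x xO; split=> [|[]]; [left|..].
rewrite -[LHS]addr0 -Z1; apply/esym/stN_setU => //.
  by move=> x xO [_ /(Z0 _ xO)].
by move=> x xO; rewrite (BC _ xO); split=> [|[|/(Z0 _ xO)]//]; left.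
Qed.

Let m (A : set (subset_type OmegaN0)) : R :=
  stN (xget (vset0 Y) [set B | vmem B FN /\ tr B = A]).

Let m_tr B : vmem B FN -> m (tr B) = stN B.
Proof.
move=> BF; rewrite /m; set Q := [set B' | _].
have [CF CB] : Q (xget (vset0 Y) Q) by apply: xgetPex; exists B.
by apply: stN_ext => //; exact: tr_ext.
Qed.

Lemma loeb_measure_exists :
  exists lam, extends_st b star FN nuN OmegaN0 lam.
Proof.
have G0 : G set0.
  have [Z ZF Z0] := FN_set0; exists Z => //.
  by apply/seteqP; split=> // -[x xO] /(Z0 _ xO).
have GU : setU_closed G.
  move=> _ _ [B BF <-] [C CF <-]; have [D DF DBC] := FN_setU BF CF; exists D => //.
  by apply/seteqP; split=> -[x xO]; rewrite /trace_set/= DBC.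
have GC : setC_closed G.
  move=> _ [B BF <-]; have [C CF CB] := FN_setC BF; exists C => //.
  by apply/seteqP; split=> -[x xO]; rewrite /trace_set/= CB.
have [|||lam lamE] := @compact_algebra_extension (subset_type OmegaN0) R G m G0 GU GC.
- by move=> _ [B BF <-]; rewrite m_tr//; exact: stN_ge0.
- move=> _ _ [B BF <-] [C CF <-] BC0; have [D DF DBC] := FN_setU BF CF.
  have <- : tr D = tr B `|` tr C.
    by apply/seteqP; split=> -[x xO]; rewrite /trace_set/= DBC.
  rewrite !m_tr//; apply: stN_setU => // x xO [xB xC].
  have : (tr B `&` tr C) (exist _ x xO : subset_type OmegaN0) by [].
  by rewrite BC0.
(* Compactness: the traces are lifted to internal sets, to which saturation applies; the common
   point lies in Omega_N because the members of F_N are included in it. *)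
- move=> F GF finF.
  have [B BE] : {B : nat -> superstructure Y & forall i, vmem (B i) FN /\ tr (B i) = F i}.
    by apply: (@choice _ _ (fun i Bi => vmem Bi FN /\ tr Bi = F i)) => i; have [B] := GF i; exists B.
  have [i|n|x xB] := star_aleph1_saturated hstar (A := B).
  + exact: FN_internal (BE i).1.
  + have [x xF] := finF n; exists (val x) => i ni.
    by have : F i x := xF i ni; rewrite -(BE i).2.
  + have xO : vmem x OmegaN by exact: FN_sub (BE 0%N).1 (xB 0%N).
    exists (exist _ x xO : subset_type OmegaN0) => i.
    by have [_ <-] := BE i; exact: xB.
exists lam => B BF; rewrite lamE; last by exists B.
by rewrite m_tr.
Qed.

(** * Integration over the completed Loeb space *)

Section loeb_integral.
Context (lam : {measure set (g_sigma_algebraType G) -> \bar R}).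
Hypothesis lamE : extends_st b star FN nuN OmegaN0 lam.
Hypothesis tails : forall e : R, 0 < e -> exists m0 : nat, forall m, (m0 <= m)%N ->
  \forall n \near \oo,
    (\int[nu n]_(x in [set x | (m%:R <= `|g n x|)%R]) `|g n x|%:E <= e%:E)%E.
Local Notation mu := (completion lam).
Local Notation W x := (ultra star (vreal b) (fN (val x))).

Lemma measurable_trace B : vmem B FN -> measurable (tr B : set (completed_type lam)).
Proof.
move=> BF; apply: sub_sigma_algebra; exists (tr B).
  by apply: sub_sigma_algebra; exists B.
by exists set0; [exact: negligible_set0|rewrite setU0].
Qed.

Lemma completion_trace B : vmem B FN ->
  (mu : {measure set (completed_type lam) -> \bar R}) (tr B) = (stN B)%:E.
Proof.
move=> BF; rewrite /= /completion measurable_mu_extE ?lamE//.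
by apply: sub_sigma_algebra; exists B.
Qed.

Lemma W_trace A : [set x | W x A] = tr (LN A).
Proof. by apply/seteqP; split=> -[x xO]; rewrite /trace_set/= fN_hyper. Qed.

(* [LN setT] and [OmegaN] are convertible. *)
Lemma W_setT x : W x setT.
Proof. by case: x => x xO; apply/fN_hyper. Qed.

(** [limit_integral] is applied along U with h the standard part of *f. The set [W^-1 A] is the
    trace of [LN A], so [extends_st] gives its measure as a standard part of nu_N, and [nuN_LN]
    identifies that with a limit along U; A = [setT] gives total mass 1. *)
Theorem loeb_integral : [/\ \forall x \ae mu, finite_hyperreal b star (fN (val x)),
  mu.-integrable setT (fun x => (st b star (fN (val x)))%:E),
  finite_hyperreal b star alphaN &
  ((st b star alphaN)%:E = \int[mu]_x (st b star (fN (val x)))%:E)%E].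
Proof.
have mgn := measurable_pull.
have tailsU (e : R) : 0 < e -> exists m0 : nat, forall m, (m0 <= m)%N ->
  \forall n \near U,
    (\int[nu n]_(x in [set x | (m%:R <= `|g n x|)%R]) `|g n x|%:E <= e%:E)%E.
  move=> e0; have [m0 Hm0] := tails e0; exists m0 => m' mm'.
  by apply: ultra_N_infinite; exact: Hm0.
have boundedP x : bounded_part (fun x : completed_type lam => W x) x <->
    finite_hyperreal b star (fN (val x)).
  split=> [[m' _ Wm]|[_ [m' /(hle_hnorm hstar _ (W_setT x)) Wm]]]; last by exists m'.
  split; first exact: W_setT.
  by exists m'; apply/(hle_hnorm hstar _ (W_setT x)).
have [] := @limit_integral R U ultra_N _ _ nu (fun n => g n) mgn _ (completed_type lam) mu
  (fun x => W x) (fun x => st b star (fN (val x))).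
- have -> : [set: completed_type lam] = tr (LN setT).
    by rewrite -W_trace; apply/seteqP; split=> // x _; exact: W_setT.
  rewrite completion_trace; last exact: LN_FN.
  have LT := LN_FN (@measurableT _ R); have [nT _] := nuN_finite LT.
  have [|_ ->//] := st_near hstar nT (r := 1) => e e0.
  apply/nuN_LN => //; apply: filterE => n /=.
  by rewrite preimage_setT probability_setT subrr normr0 ltW.
- by move=> x; apply: (ultra_filter hstar (@vreal_inj _ _ _ _ b) (ranked_vreal b)); exact: W_setT.
- by move=> x; apply: (ultraC hstar (@vreal_inj _ _ _ _ b) (ranked_vreal b)); exact: W_setT.
- by move=> A mA; rewrite W_trace; apply: measurable_trace; exact: LN_FN.
- move=> A mA; rewrite W_trace completion_trace/=; last exact: LN_FN.
  apply/cvgrPdist_le => /= e e0.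
  have := finite_near_st hstar (nuN_finite (LN_FN mA)) e0.
  move=> /(nuN_LN _ mA); apply: filterS => n /=.
  by rewrite distrC.
- by move=> x /boundedP fx e e0; exact: finite_near_st.
(* Where *f is not finite, [st] takes its default value 0, as the limit theorem requires outside
   [bounded_part]. *)
- move=> x bx; rewrite /st xgetPN// => r [fx _]; apply: bx; exact/boundedP.
- exact: tailsU.
move=> bp_ae ih; set r := Rintegral _ _ _ => lim_h.
have [m1 Hm1] := tails ltr01.
have ig : \forall n \near \oo, (nu n).-integrable setT (EFin \o g n).
  apply: filterS (Hm1 m1 (leqnn m1)) => n Hn.
  apply: (tail_integrable (probability_setT (nu n)) (mgn n) (ler0n _ m1)).
  by rewrite (le_lt_trans Hn)// ltry.
have aT : ultra star (vreal b) alphaN setT by apply/(alphaN_hyper _ ig); exact: filterT.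
have [|fa sta] := st_near hstar aT (r := r).
  move=> e e0; apply/(alphaN_hyper _ ig).
  move/cvgrPdist_le : lim_h => /(_ _ e0); apply: filterS => n /=.
  by rewrite distrC.
split; [|exact: ih|exact: fa|].
  by apply: filterS bp_ae => x /boundedP.
by rewrite sta /r /Rintegral (fineK (integrable_fin_num measurableT ih)).
Qed.

End loeb_integral.

End internal_space.

(** Once L m < e, the inner limit bounds u m n for large n, with a threshold depending on m. This
    order of quantifiers suffices, because every use fixes m before n. *)
Lemma iterated_limit_tails (R : realType) (u : nat -> nat -> \bar R) :
  (exists L : nat -> \bar R,
    (\forall m \near \oo, u m n @[n --> \oo] --> L m) /\ L m @[m --> \oo] --> 0%E) ->
  forall e : R, 0 < e -> exists m0 : nat, forall m, (m0 <= m)%N ->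
    \forall n \near \oo, (u m n <= e%:E)%E.
Proof.
move=> [L [uL L0]] e e0.
have e0E : (0%:E < e%:E)%E by rewrite lte_fin.
have Le : \forall m \near \oo, (L m < e%:E)%E by exact: (L0 _ (open_ereal_lt' e0E)).
have [m0 _ Hm0] := filterI uL Le; exists m0 => m /Hm0[um Lm].
have : \forall n \near \oo, (u m n < e%:E)%E by exact: (um _ (open_ereal_lt' Lm)).
by apply: filterS => n /ltW.
Qed.

Theorem theorem4p1 (R : realType) (d : measure_display) (E : measurableType d)
    (X Y : Type) (b : base_embedding R E X)
    (star : superstructure X -> superstructure Y)
    (hstar : nonstandard_extension star)
    (k : nat) (np : nat -> nat) (knp : forall n, (k < np n)%N)
    (Omega : forall n, set ((np n).-tuple E))
    (Omega0 : forall n, Omega n !=set0)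
    (nu : forall n, probability (induced_space (Omega0 n)) R)
    (f : k.-tuple E -> R) (mf : measurable_fun [set: k.-tuple E] f)
    (hf : exists L : nat -> \bar R,
      (\forall m \near \oo,
        (\int[nu n]_(x in [set x | (m%:R <= `|pull knp Omega0 f n x|)%R])
          (`|pull knp Omega0 f n x|%R)%:E)%E @[n --> \oo] --> L m) /\
      L m @[m --> \oo] --> 0%E) :
  (\forall n \near \oo,
    (nu n).-integrable [set: induced_space (Omega0 n)]
      (fun x => (pull knp Omega0 f n x)%:E)) /\
  forall N : superstructure Y, infinite_hypernat b star N ->
    let OmegaN := vapp (star (vOmega_seq b k Omega0)) N in
    let FN := vapp (star (vF_seq b k Omega0)) N in
    let nuN := vapp (star (vnu_seq b k nu)) N in
    let projN := vapp (star (vproj_seq b knp)) N in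
    let alphaN := vapp (star (valpha_seq b knp nu f)) N in
    let fN (x : superstructure Y) := vapp (star (vf b f)) (vapp projN x) in
    exists OmegaN0 : members OmegaN !=set0,
      (exists lam, extends_st b star FN nuN OmegaN0 lam) /\
      (forall lam, extends_st b star FN nuN OmegaN0 lam ->
        let LnuN := completion lam in
        [/\ \forall x \ae LnuN, finite_hyperreal b star (fN (subset_val OmegaN0 x)),
            LnuN.-integrable [set: completed_type lam]
              (fun x => (st b star (fN (subset_val OmegaN0 x)))%:E),
            finite_hyperreal b star alphaN &
            ((st b star alphaN)%:E =
              \int[LnuN]_x (st b star (fN (subset_val OmegaN0 x)))%:E)%E]).
Proof.
have tails := iterated_limit_tails hf.
split.
  have [m Hm] := tails _ ltr01; apply: filterS (Hm m (leqnn m)) => n Hn.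
  apply: (tail_integrable (probability_setT (nu n)) _ (ler0n _ m)).
    exact: measurable_pull.
  by rewrite (le_lt_trans Hn)// ltry.
move=> N N_inf OmegaN FN nuN projN alphaN fN.
have ON : members OmegaN !=set0 := OmegaN_nonempty hstar k Omega0 N_inf.
exists ON; split; first exact: (loeb_measure_exists hstar nu N_inf ON).
by move=> lam lamE; exact: (loeb_integral hstar mf N_inf lamE tails).
Qed.
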